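(* Let $\mathcal{S}=(\mathbb{E},\mathbb{E}_\vee,\mathbb{E}_<,\Gamma)$ be a Euclidean cut and project scheme with (possibly multi-coloured) polytopal window $W$, positioned so that $\mathbf{0}\in\mathrm{Ver}(W)$. Assume there is a linear automorphism $M\colon\mathbb{E}\to\mathbb{E}$ with $M(\Gamma)=\Gamma$, $M(\mathbb{E}_\vee)=\mathbb{E}_\vee$, $M(\mathbb{E}_<)=\mathbb{E}_<$ and with $L:=M|_{\mathbb{E}_\vee}$ expansive. Assume that the elements of $\Omega=\Omega(\mathcal{S},W)$ are $L^m$-sub for some $m\in\mathbb{N}$, $m\ge1$. Then $\Lambda\in\Omega$ is LIDS (equivalently, pseudo self-affine, or fixed by a substitution map $\sigma\colon\Omega\to\Omega$) with respect to some power $L^p$, $p\ge1$, of the expansion if and only if $\tau(\Lambda)=[u]$ for some $u\in\mathbb{E}$ with $u_<\in\mathbb{Q}\Gamma_<$.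
   Context: **Patterns.** A Delone multiset in a finite-dimensional real normed space $E$ is a tuple $\Lambda=(\Lambda_1,\dots,\Lambda_\ell)$ of subsets of $E$ whose union is uniformly discrete and relatively dense. Translates $\Lambda+x$ and linear images $L\Lambda$ are taken componentwise. A patch of $\Lambda$ is a tuple $(\Lambda_i\cap U)_i$ with $U$ bounded. With $B(x,r)$ the closed ball, $\Lambda[x,r]:=((\Lambda_i\cap B(x,r))-x)_i$. $\mathcal{Q}$ is locally derivable (LD) from $\mathcal{P}$ if there is $c\ge0$ such that for all $x,y\in E$, $\mathcal{P}[x,c]=\mathcal{P}[y,c]$ implies $\mathcal{Q}[x,0]=\mathcal{Q}[y,0]$; MLD if each is LD from the other. $\mathcal{P}$ is locally indistinguishable (LI) from $\mathcal{Q}$ if every patch of $\mathcal{P}$ occurs, up to translation, in $\mathcal{Q}$. The hull $\Omega_{\mathcal{P}}$ is the set of all patterns LI from $\mathcal{P}$, with the local topology (two patterns are close if they agree on a large ball about the origin up to a small translation). For a linear automorphism $L$ of $E$: $\mathcal{P}$ is $L$-sub if there is $\mathcal{P}'$, LI from $\mathcal{P}$, such that $\mathcal{P}$ is LD from $L\mathcal{P}'$; $\mathcal{P}$ is pseudo self-affine with respect to $L$ if $\mathcal{P}$ is LD from $L\mathcal{P}$; $\mathcal{P}$ is LIDS with respect to $L$ if $L\mathcal{P}$ and $\mathcal{P}$ are MLD. A linear map is expansive if all its eigenvalues have modulus $>1$. A substitution map with inflation $L$ is $\sigma=S\circ L\colon\Omega\to\Omega$, where $L\colon\Omega\to L\Omega$,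 $\mathcal{U}\mapsto L\mathcal{U}$, and $S\colon L\Omega\to\Omega$ is a local derivation map: there is $c\ge0$ such that $\mathcal{U}[x,c]=\mathcal{V}[y,c]$ implies $S(\mathcal{U})[x,0]=S(\mathcal{V})[y,0]$ for all $\mathcal{U},\mathcal{V}\in L\Omega$ and $x,y\in E$. **Cut and project.** A Euclidean cut and project scheme $\mathcal{S}=(\mathbb{E},\mathbb{E}_\vee,\mathbb{E}_<,\Gamma)$ consists of a $k$-dimensional real vector space $\mathbb{E}$, complementary subspaces $\mathbb{E}_\vee$ of dimension $d>0$ and $\mathbb{E}_<$ of dimension $k-d>0$, and a full rank lattice $\Gamma\subset\mathbb{E}$. Write $x_\vee,x_<$ for the projections of $x$ to $\mathbb{E}_\vee,\mathbb{E}_<$ along $\mathbb{E}=\mathbb{E}_\vee\oplus\mathbb{E}_<$. It is required that $\gamma\mapsto\gamma_\vee$, $\gamma\mapsto\gamma_<$ are injective on $\Gamma$ and $\Gamma_<$ is dense in $\mathbb{E}_<$. A window is a finite tuple $W=(W_i)_{i=1}^\ell$ of compact, topologically regular (equal to the closure of their interior) subsets of $\mathbb{E}_<$. It is non-singular if $\Gamma_<\cap\partial W_i=\emptyset$ for all $i$; then $\Lambda(\mathcal{S},W)=(\Lambda_i)_i$, $\Lambda_i=\{\gamma_\vee:\gamma\in\Gamma,\gamma_<\in W_i\}$. For arbitrary $W$, $\Omega(\mathcal{S},W):=\Omega_{\Lambda(\mathcal{S},W+s)}$ for any $s\in\mathbb{E}_<$ with $W+s$ non-singular (independent of $s$). A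 point $x\in\mathbb{E}$ is non-singular if $x_<\notin\bigcup_i\bigcup_{g\in\Gamma_<}(\partial W_i+g)$. The torus parametrisation $\tau\colon\Omega(\mathcal{S},W)\to\mathbb{T}=\mathbb{E}/\Gamma$ is the unique continuous map with $\tau(\Lambda_x)=[x]$ for all non-singular $x$, where $\Lambda_x$ has $i$th component $\{(\gamma+x)_\vee:\gamma\in\Gamma,(\gamma+x)_<\in W_i\}$. $\mathbb{Q}\Gamma_<=\bigcup_{N\ge1}\frac1N\Gamma_<$. **Polytopal windows.** An affine hyperplane $H\subset\mathbb{E}_<$ is supporting for a compact topologically regular $X\subset\mathbb{E}_<$ if there are $w\in H\cap X$, an open neighbourhood $U$ of $w$ and a closed half-space $H^+$ bounded by $H$ with $X\cap U=H^+\cap U$. $X$ is polytopal if $\partial X$ is contained in a finite union of supporting hyperplanes (equivalently, $X$ is a finite union of convex polytopes with non-empty interior); $W$ is polytopal if each $W_i$ is. $\mathrm{Ver}(W)$ is the union of the vertex sets (0-cells of the polytope cell structure) of the $W_i$; a vertex of a polytope $X$ is a point $v\in\partial X$ at which the tangent cone of $X$ is not invariant under translation along any line. *)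

(* Defs.v *)
From HB Require Import structures.
From mathcomp Require Import all_boot all_order all_algebra.
From mathcomp Require Import all_classical all_reals all_analysis.
From mathcomp Require Import complex.

Set Implicit Arguments.
Unset Strict Implicit.
Unset Printing Implicit Defensive.

Import Order.TTheory GRing.Theory Num.Theory.
Import numFieldNormedType.Exports.

Local Open Scope classical_set_scope.
Local Open Scope quotient_scope.
Local Open Scope ring_scope.

#[short(type="finNormedModType")]
HB.structure Definition FinNormedModule (R : realType) :=
  {E of NormedModule R E & Vector R E}.

HB.instance Definition _ (R : realType) (n : nat) :=
  NormedModule.on 'rV[R]_n.

(* A linear subspace carries the restriction of the ambient norm. *)
Section SubspaceNorm.
Context (R : realType) (E : finNormedModType R) (U : {vspace E}).

Let subnorm (u : subvs_of U) : R := `|vsval u|.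

Let ler_subnormD u v : subnorm (u + v) <= subnorm u + subnorm v.
Proof. exact: ler_normD. Qed.

Let subnormZ (a : R) u : subnorm (a *: u) = `|a| * subnorm u.
Proof. by rewrite /subnorm linearZ/= normrZ. Qed.

Let subnorm0_eq0 u : subnorm u = 0 -> u = 0.
Proof. by move=> /normr0_eq0 u0; apply: val_inj; rewrite /= u0. Qed.

HB.instance Definition _ := Lmodule_isNormed.Build R (subvs_of U)
  ler_subnormD subnormZ subnorm0_eq0.

End SubspaceNorm.

Section LinearMaps.
Context (R : realType) (V : finNormedModType R).

Definition lfun_exp (f : 'End(V)) (p : nat) : 'End(V) :=
  iter p (comp_lfun f) \1%VF.

Definition automorphism (f : 'End(V)) : Prop := lker f == 0%VS.

(* Complex eigenvalues are those of the matrix of f, hence the passage to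
   R[i]; the modulus `|z| and the order are those of R[i]. *)
Definition expansive (f : 'End(V)) : Prop :=
  forall z : R[i],
    eigenvalue (map_mx (real_complex R)
                  (passmx.mxof (vbasis {:V}) (vbasis {:V}) f)) z ->
    1 < `|z|.

End LinearMaps.

Section Patterns.
Context (R : realType) (V : finNormedModType R).

Definition colored (l : nat) := 'I_l -> set V.

Definition translate l (P : colored l) (x : V) : colored l :=
  fun i => [set y + x | y in P i].

Definition lin_image l (f : 'End(V)) (P : colored l) : colored l :=
  fun i => f @` P i.

Definition cball (x : V) (r : R) : set V := closed_ball_ Num.norm x r.

(* P[x, r] *)
Definition central_patch l (P : colored l) (x : V) (r : R) : colored l :=
  translate (fun i => P i `&` cball x r) (- x).

Definition uniformly_discrete (A : set V) : Prop :=
  exists2 r : R, 0 < r &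
    forall x y, A x -> A y -> x != y -> r <= `|x - y|.

Definition relatively_dense (A : set V) : Prop :=
  exists r : R, forall x, exists2 y, A y & `|x - y| <= r.

Definition delone l (P : colored l) : Prop :=
  uniformly_discrete (\bigcup_i P i) /\ relatively_dense (\bigcup_i P i).

(* Q is locally derivable from P *)
Definition LD l1 l2 (Q : colored l1) (P : colored l2) : Prop :=
  exists2 c : R, 0 <= c &
    forall x y, central_patch P x c = central_patch P y c ->
                central_patch Q x 0 = central_patch Q y 0.

Definition MLD l1 l2 (P : colored l1) (Q : colored l2) : Prop :=
  LD P Q /\ LD Q P.

(* P is locally indistinguishable from Q.  A patch remembers the bounded
   region U that it is cut out with: comparing only the finite sets of points
   would make every subset of a pattern indistinguishable from it. *)
Definition LI l (P Q : colored l) : Prop :=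
  forall U : set V, bounded_set U ->
    exists t : V, forall i,
      [set x + t | x in P i `&` U] = Q i `&` [set x + t | x in U].

Definition hull l (P : colored l) : set (colored l) :=
  [set Q | delone Q /\ LI Q P].

(* Neighbourhoods of P in the local topology: the patterns agreeing with P on
   a large ball about 0, up to a small translation. *)
Definition local_nbhs l (P : colored l) : set_system (colored l) :=
  [set N | exists r e : R, [/\ 0 < r, 0 < e &
    forall Q t, `|t| <= e ->
      central_patch (translate P t) 0 r = central_patch Q 0 r -> N Q]].

Definition is_sub l (f : 'End(V)) (P : colored l) : Prop :=
  exists P' : colored l, [/\ delone P', LI P' P & LD P (lin_image f P')].

Definition pseudo_self_affine l (f : 'End(V)) (P : colored l) : Prop :=
  LD P (lin_image f P).

Definition LIDS l (f : 'End(V)) (P : colored l) : Prop :=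
  MLD (lin_image f P) P.

Definition local_derivation_map l (D D' : set (colored l))
    (S : colored l -> colored l) : Prop :=
  (forall P, D P -> D' (S P)) /\
  exists2 c : R, 0 <= c &
    forall P Q, D P -> D Q ->
      forall x y, central_patch P x c = central_patch Q y c ->
                  central_patch (S P) x 0 = central_patch (S Q) y 0.

Definition substitution_map l (O : set (colored l)) (f : 'End(V))
    (sigma : colored l -> colored l) : Prop :=
  exists2 S : colored l -> colored l,
    local_derivation_map [set lin_image f P | P in O] O S &
    forall P, O P -> sigma P = S (lin_image f P).

End Patterns.

Section Windows.
Context (R : realType) (V : finNormedModType R).

Definition boundary (X : set V) : set V := closure X `\` X°.

Definition window l (W : colored V l) : Prop :=
  forall i, compact (W i) /\ W i = closure (W i)°.

(* Hp is a closed half-space bounded by the affine hyperplane H; replacing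
   (phi, c) by (- phi, - c) gives the other side. *)
Definition half_space_bounded_by (H Hp : set V) : Prop :=
  exists (phi : 'Hom(V, R^o)) (c : R),
    [/\ phi != 0, H = [set x | phi x = c] & Hp = [set x | phi x <= c]].

Definition supporting (X H : set V) : Prop :=
  exists w U Hp, [/\ (H `&` X) w, open_nbhs w U,
    half_space_bounded_by H Hp & X `&` U = Hp `&` U].

Definition polytopal (X : set V) : Prop :=
  exists2 Hs : set (set V), finite_set Hs &
    (forall H, Hs H -> supporting X H) /\
    boundary X `<=` \bigcup_(H in Hs) H.

Definition polytopal_window l (W : colored V l) : Prop :=
  window W /\ forall i, polytopal (W i).

Definition tangent_cone (X : set V) (v : V) : set V :=
  [set u | exists2 e : R, 0 < e & forall t, 0 <= t <= e -> X (v + t *: u)].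

Definition vertex (X : set V) : set V :=
  [set v | boundary X v /\
    ~ exists2 a : V, a != 0 &
        forall (t : R) u, tangent_cone X v u -> tangent_cone X v (u + t *: a)].

Definition Ver l (W : colored V l) : set V := \bigcup_i vertex (W i).

End Windows.

Section CutAndProject.
Context (R : realType) (E : finNormedModType R).

Definition full_rank_lattice (G : set E) : Prop :=
  exists2 b : (\dim {:E}).-tuple E, basis_of {:E} b & G = inIntSpan b.

(* The projection to U along W, as a point of U. *)
Definition proj_along (U W : {vspace E}) (x : E) : subvs_of U :=
  vsproj U (daddv_pi U W x).

Record cps := CutProjectScheme {
  phys : {vspace E};
  intl : {vspace E};
  lattice : set E;
  dim_phys_gt0 : (0 < \dim phys)%N;
  dim_intl_gt0 : (0 < \dim intl)%N;
  phys_add_intl : (phys + intl)%VS = {:E}%VS;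
  phys_cap_intl : (phys :&: intl)%VS = 0%VS;
  lattice_full_rank : full_rank_lattice lattice;
  proj_phys_inj : set_inj lattice (proj_along phys intl);
  proj_intl_inj : set_inj lattice (proj_along intl phys);
  proj_intl_dense : dense (proj_along intl phys @` lattice)
}.

Context (S : cps).

Definition to_phys (x : E) : subvs_of (phys S) := proj_along (phys S) (intl S) x.
Definition to_intl (x : E) : subvs_of (intl S) := proj_along (intl S) (phys S) x.

Lemma lattice0 : lattice S 0.
Proof.
have [b _ ->] := lattice_full_rank S; exists [ffun=> 0].
by rewrite big1// => i _; rewrite ffunE mulr0z.
Qed.

Lemma latticeB x y : lattice S x -> lattice S y -> lattice S (x - y).
Proof.
have [b _ ->] := lattice_full_rank S.
move=> [c ->] [c' ->]; exists [ffun i => c i - c' i].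
by rewrite -sumrB; apply: eq_bigr => i _; rewrite ffunE mulrzBr.
Qed.

Definition torus_rel (x y : E) : bool := `[< lattice S (x - y) >].

Lemma torus_rel_equiv : equiv_class_of torus_rel.
Proof.
have sym x y : lattice S (x - y) -> lattice S (y - x).
  by move=> xy; rewrite -opprB -sub0r; apply: latticeB => //; exact: lattice0.
split.
- by move=> x; apply/asboolP; rewrite subrr; exact: lattice0.
- by move=> x y; apply: asbool_equiv_eq; split; exact: sym.
- move=> y x z /asboolP xy /asboolP yz; apply/asboolP.
  rewrite (_ : x - z = (x - y) - (z - y)); first by apply: latticeB => //; exact: sym.
  by rewrite opprB addrA subrK.
Qed.

Definition torus_equiv : equiv_rel E := EquivRelPack torus_rel_equiv.

Definition torus := quotient_topology {eq_quot torus_equiv}.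

Definition torus_class (x : E) : torus := \pi_torus x.

Definition nonsingular_window l (W : colored (subvs_of (intl S)) l) : Prop :=
  forall i, (to_intl @` lattice S) `&` boundary (W i) = set0.

Definition model_set l (W : colored (subvs_of (intl S)) l) :
    colored (subvs_of (phys S)) l :=
  fun i => [set to_phys g | g in [set g | lattice S g /\ W i (to_intl g)]].

Section Window.
Context (l : nat) (W : colored (subvs_of (intl S)) l).

(* The hull does not depend on the choice of s. *)
Definition Omega : set (colored (subvs_of (phys S)) l) :=
  [set P | exists2 s, nonsingular_window (translate W s) &
             hull (model_set (translate W s)) P].

Definition nonsingular_point (x : E) : Prop :=
  ~ (\bigcup_i \bigcup_(g in to_intl @` lattice S)
       [set y + g | y in boundary (W i)]) (to_intl x).

Definition model_set_at (x : E) : colored (subvs_of (phys S)) l :=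
  fun i => [set to_phys (g + x) |
             g in [set g | lattice S g /\ W i (to_intl (g + x))]].

(* These two properties determine tau on Omega; its values elsewhere are
   irrelevant. *)
Definition torus_parametrisation
    (tau : colored (subvs_of (phys S)) l -> torus) : Prop :=
  (forall P, Omega P -> tau @ within Omega (local_nbhs P) --> tau P) /\
  (forall x, nonsingular_point x -> tau (model_set_at x) = torus_class x).

End Window.

(* Q Gamma_< *)
Definition rational_intl : set (subvs_of (intl S)) :=
  [set v | exists N g, [/\ (0 < N)%N, lattice S g &
             v = (N%:R : R)^-1 *: to_intl g]].

(* M restricted to E_vee; only meaningful if M maps E_vee to itself. *)
Definition phys_restr (M : 'End(E)) : 'End(subvs_of (phys S)) :=
  linfun (vsproj (phys S) \o M \o vsval).

End CutAndProject.

Arguments to_phys {R E} S x.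
Arguments to_intl {R E} S x.
Arguments torus_class {R E} S x.
Arguments rational_intl {R E} S.
Arguments phys_restr {R E} S M.

(* Main.v *)
(* Index the torus fibres by u = (a, w) with a in E_vee and w in E_<, and write
   A = M|_{E_<}. Local derivability P from L^n P' produces, the hull being minimal,
   a substitution map sigma on Omega with sigma P' = P, and patterns that agree on
   a large ball have close torus parameters modulo the lattice; hence sigma acts on
   parameters by an affine map w |-> A^n w + c.
   The crux is that the translation part of some iterate of sigma lies in Gamma_<.
   Since L contracts backwards, sigma^j is a derivation with radius independent of
   j. So near the point v_j with A^(jn) v_j = - c_j, where c_j is the translation
   part of sigma^j, the shrunk window A^(-jn) W_i0 is a Boolean combination of
   boundedly many lattice translates of the windows. As 0 is a vertex of W_i0, the
   boundary hyperplanes through v_j meet in a point only. This leaves finitely many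
   v_j modulo Gamma_<, so two of them agree modulo Gamma_<.
   If P is pseudo self-affine, then sigma P = P and (A^(jn) - 1) w lies in
   Gamma_<. As M^(jn) - 1 is injective on the lattice, w is rational.
   If w is rational, then A^j w - w lies in Gamma_< for many j, so a power of the
   substitution, translated back, permutes the finite fibre over u. A further
   power fixes P, which is therefore derivable from some L^n P.
   That L^n P is then derivable from P is Solomyak's recognizability argument. *)

From HB Require Import structures.
Require Import Defs.
From mathcomp Require Import all_boot all_order all_algebra.
From mathcomp Require Import all_classical all_reals all_analysis.
From mathcomp Require Import complex ring lra zify.
Import Order.TTheory GRing.Theory Num.Theory.
Import numFieldNormedType.Exports.
Local Open Scope classical_set_scope.
Local Open Scope ring_scope.

Set Implicit Arguments.
Unset Strict Implicit.
Unset Printing Implicit Defensive.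

(** Singular parameters shape the proof: there lattice points project onto the boundary of a window,
    and several patterns may share one parameter. Two notions deal with this. [sandwich] leaves
    boundary points undecided and suffices for comparing parameters; [approx] describes a pattern as
    a limit of non-singular model sets, and substitutions are transported along it. In both, the
    physical part is exact and only the internal part is approximated: two patterns with a common
    point have physical parameters that differ by exactly some [p g]. Shrunken windows are never
    formed. Instead, whether the origin has colour [i0] in the n-th iterate is read off from a ball
    whose radius does not depend on [n], and this patch changes only when the internal parameter
    crosses a hyperplane. A fibre is finite because each patch in it is determined by the sides of
    finitely many hyperplanes from which the parameter is approached. A substitution that fixes the
    parameter is onto the fibre by compactness. Onto and finite give periodicity. *)

Section ZmoduleIdentities.

Inductive zexpr := ZVar of nat | ZZero | ZAdd of zexpr & zexpr | ZOpp of zexpr.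

Fixpoint zeval (E : zmodType) (env : seq E) (e : zexpr) : E :=
  match e with
  | ZVar i => nth 0 env i
  | ZZero => 0
  | ZAdd e1 e2 => zeval env e1 + zeval env e2
  | ZOpp e1 => - zeval env e1
  end.

Fixpoint zcoef (e : zexpr) (i : nat) : int :=
  match e with
  | ZVar j => (i == j)%:Z
  | ZZero => 0
  | ZAdd e1 e2 => zcoef e1 i + zcoef e2 i
  | ZOpp e1 => - zcoef e1 i
  end.

Lemma zevalE (E : zmodType) (env : seq E) e :
  zeval env e = \sum_(i < size env) env`_i *~ zcoef e i.
Proof.
elim: e => [j||e1 IH1 e2 IH2|e IH] /=.
- have [jn|jn] := ltnP j (size env).
    rewrite (bigD1 (Ordinal jn))//= eqxx mulr1z big1 ?addr0// => i.
    by rewrite -val_eqE /= => /negPf ->; rewrite mulr0z.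
  rewrite nth_default// big1// => i _.
  by rewrite [_ == j]ltn_eqF ?mulr0z//; exact: leq_trans (ltn_ord i) jn.
- by rewrite big1// => i _; rewrite mulr0z.
- by rewrite IH1 IH2 -big_split; apply: eq_bigr => i _; rewrite mulrzDr.
- by rewrite IH -sumrN; apply: eq_bigr => i _; rewrite mulrNz.
Qed.

Lemma zeval_eq (E : zmodType) (env : seq E) e1 e2 :
  all (fun i => zcoef e1 i == zcoef e2 i) (iota 0 (size env)) ->
  zeval env e1 = zeval env e2.
Proof.
move=> /allP h; rewrite !zevalE; apply: eq_bigr => i _.
by rewrite (eqP (h i _))// mem_iota add0n ltn_ord.
Qed.

End ZmoduleIdentities.

Ltac zinsert x env :=
  lazymatch env with
  | context [cons x _] => env
  | _ => constr:(cons x env)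
  end.

Ltac zatoms t env :=
  lazymatch t with
  | Algebra.add ?a ?b => let env := zatoms a env in zatoms b env
  | Algebra.opp ?a => zatoms a env
  | Algebra.zero => env
  | ?x => zinsert x env
  end.

Ltac zindex x env :=
  lazymatch env with
  | cons x _ => constr:(O)
  | cons _ ?l => let k := zindex x l in constr:(S k)
  end.

Ltac zreify t env :=
  lazymatch t with
  | Algebra.add ?a ?b =>
      let e1 := zreify a env in let e2 := zreify b env in constr:(ZAdd e1 e2)
  | Algebra.opp ?a => let e := zreify a env in constr:(ZOpp e)
  | Algebra.zero => constr:(ZZero)
  | ?x => let k := zindex x env in constr:(ZVar k)
  end.

(* Proves identities between sums and differences in an abelian group, which
   [ring] cannot do for want of a multiplication. *)
Ltac zmod :=
  lazymatch goal with
  | |- @eq ?E ?x ?y =>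
      let env := zatoms x (@nil E) in
      let env := zatoms y env in
      let e1 := zreify x env in
      let e2 := zreify y env in
      refine (@zeval_eq _ env e1 e2 _); vm_compute; reflexivity
  end.

(** * Agreement of patterns on balls, as a common language for patches, [LD] and [LI] *)

Section Agreement.
Context (R : realType) (X : finNormedModType R).

(** Unlike equality of central patches, this shifts, restricts and composes by arithmetic on
    radii. *)
Definition agree l (r : R) (P : colored X l) (x : X) (Q : colored X l) (y : X) :=
  forall s i, `|s| <= r -> (P i (x + s) <-> Q i (y + s)).

Lemma agree_refl l r (P : colored X l) x : agree r P x P x.
Proof. by []. Qed.

Lemma agree_sym l r (P Q : colored X l) x y : agree r P x Q y -> agree r Q y P x.
Proof. by move=> h s i sr; split=> /(h s i sr). Qed.

Lemma agree_trans l r (P Q T : colored X l) x y z :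
  agree r P x Q y -> agree r Q y T z -> agree r P x T z.
Proof. by move=> h k s i sr; rewrite (h s i sr); exact: k. Qed.

Lemma agree_le l r r' (P Q : colored X l) x y :
  r' <= r -> agree r P x Q y -> agree r' P x Q y.
Proof. by move=> rr h s i sr; apply: h; exact: le_trans sr rr. Qed.

Lemma agree_shift l r r' t (P Q : colored X l) x y :
  `|t| + r' <= r -> agree r P x Q y -> agree r' P (x + t) Q (y + t).
Proof.
move=> trr h s i sr; rewrite -!addrA; apply: h.
by rewrite (le_trans (ler_normD _ _))// (le_trans _ trr)// lerD2l.
Qed.

Lemma translateE l (P : colored X l) t i x : translate P t i x <-> P i (x - t).
Proof.
split=> [[y Py <-]|Px]; first by rewrite addrK.
by exists (x - t) => //; rewrite subrK.
Qed.

Lemma agree_translatel l r (P Q : colored X l) t x y :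
  agree r (translate P t) x Q y <-> agree r P (x - t) Q y.
Proof.
split=> h s i sr; have := h s i sr; rewrite translateE.
  by rewrite addrAC.
by rewrite addrAC.
Qed.

Lemma colored_ext l (P Q : colored X l) :
  (forall i x, P i x <-> Q i x) -> P = Q.
Proof. by move=> PQ; apply/funext => i; apply/seteqP; split=> x /PQ. Qed.

Lemma translate0 l (P : colored X l) : translate P 0 = P.
Proof. by apply: colored_ext => i x; rewrite translateE subr0. Qed.

Lemma central_patchP l r (P Q : colored X l) x y :
  central_patch P x r = central_patch Q y r <-> agree r P x Q y.
Proof.
have cpE (T : colored X l) z i s :
    central_patch T z r i s <-> T i (z + s) /\ `|s| <= r.
  rewrite /central_patch translateE opprK [s + z]addrC.
  by rewrite /setI /cball /closed_ball_ /= opprD addNKr normrN.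
split=> [e s i sr|h].
  move: (cpE P x i s) (cpE Q y i s); rewrite e => -[h1 h2] [h3 h4].
  by split=> h; [case: (h3 (h2 (conj h sr)))|case: (h1 (h4 (conj h sr)))].
apply: colored_ext => i s; rewrite !cpE.
by split=> -[hP sr]; split=> //; apply/(h s i sr).
Qed.

Lemma LDP l1 l2 (Q : colored X l1) (P : colored X l2) :
  LD Q P <-> exists2 c : R, 0 <= c &
    forall x y, agree c P x P y -> forall i, Q i x <-> Q i y.
Proof.
split=> -[c c0 h]; exists c => // x y.
  move=> /central_patchP/h/central_patchP e i.
  by have := e 0 i; rewrite normr0 !addr0; exact.
move=> /central_patchP/h e; apply/central_patchP => s i.
by rewrite normr_le0 => /eqP ->; rewrite !addr0.
Qed.

Lemma cball0E (x : X) r : cball 0 r x = (`|x| <= r) :> Prop.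
Proof. by rewrite /cball /closed_ball_ /= sub0r normrN. Qed.

Lemma bounded_cball (r : R) : bounded_set (cball (0 : X) r).
Proof.
exists r; split; first exact: num_real.
by move=> M rM x /=; rewrite cball0E => /le_trans; apply; exact: ltW.
Qed.

Lemma LIP l (P Q : colored X l) :
  LI P Q <-> forall r, exists t, agree r P 0 Q t.
Proof.
split=> [h r|h U [M [_ hM]]].
  have [t ht] := h _ (bounded_cball r).
  exists t => s i sr; move/seteqP: (ht i) => [h1 h2]; split=> Ps.
    have /= [|//] := h1 (t + s); exists s; last by rewrite addrC.
    by rewrite add0r in Ps; split=> //; rewrite cball0E.
  have /= [|x [Px _] /eqP] := h2 (t + s).
    by split=> //; exists s; [rewrite cball0E|rewrite addrC].
  by rewrite addrC => /eqP /addrI <-; rewrite add0r.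
have [t ht] := h (`|M| + 1); exists t => i; apply/seteqP; split=> x /=.
  move=> [y [Py Uy] <-]; split; last by exists y.
  rewrite addrC; apply/(ht y); last by rewrite add0r.
  by apply: hM => //; rewrite ltr_pwDr// ler_norm.
move=> [Qx [y Uy yx]]; exists y => //; split => //.
rewrite -[y]add0r; apply/(ht y); last by rewrite addrC yx.
by apply: hM => //; rewrite ltr_pwDr// ler_norm.
Qed.

Lemma LI_trans l (P Q T : colored X l) : LI P Q -> LI Q T -> LI P T.
Proof.
move=> /LIP h /LIP k; apply/LIP => r; have [t ht] := h r.
have [u hu] := k (`|t| + r); exists (u + t).
apply: agree_trans ht _.
by have := agree_shift (lexx _) hu; rewrite add0r.
Qed.

Lemma LI_at l (P Q : colored X l) r x : LI P Q -> exists t, agree r P x Q t.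
Proof.
move=> /LIP /(_ (`|x| + r)) [t ht]; exists (t + x).
by have := agree_shift (lexx _) ht; rewrite add0r.
Qed.

(** Both properties are tested on bounded pieces, and every bounded piece of [P] is a translate of a
    piece of [Q]. *)
Lemma delone_LI l (P Q : colored X l) : LI P Q -> delone Q -> delone P.
Proof.
move=> PQ [[e e0 ud] [r rd]]; split.
  exists e => // x y [i _ Px] [j _ Py] xy.
  have [t ht] := LI_at `|y - x| x PQ.
  have Qx : Q i (t + 0) by apply/ht; rewrite ?normr0// addr0.
  have Qy : Q j (t + (y - x)) by apply/ht; rewrite // addrC subrK.
  have := ud _ _ (ex_intro2 _ _ i I Qx) (ex_intro2 _ _ j I Qy).
  have e1 : t - (t + (y - x)) = x - y by rewrite opprD addrA subrr sub0r opprB.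
  by rewrite addr0 -[_ != _]negbK -subr_eq0 e1 subr_eq0 negbK; exact.
exists r => x; have [t ht] := LI_at r x PQ.
have [y [i _ Qy] ty] := rd t; exists (x + (y - t)).
  by exists i => //; apply/ht; rewrite ?(distrC y)// addrC subrK.
by rewrite opprD addNKr opprB.
Qed.

Lemma lin_imageE l (f : 'End(X)) (P : colored X l) i x :
  injective f -> lin_image f P i (f x) <-> P i x.
Proof.
move=> finj; split=> [[y Py /finj <-]//|Px]; by exists x.
Qed.

End Agreement.

(** * Topology through the norm, and linear maps in finite dimension *)

Section NormedTopology.
Context (R : realType) (E : normedModType R).

Lemma interior_normP (A : set E) x :
  A° x <-> exists2 e : R, 0 < e & forall y, `|x - y| < e -> A y.
Proof.
by split=> [/nbhs_normP[e /= e0 h]|[e e0 h]]; [|apply/nbhs_normP]; exists e.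
Qed.

Lemma open_normP (A : set E) x : open A -> A x ->
  exists2 e : R, 0 < e & forall y, `|x - y| < e -> A y.
Proof. by rewrite openE => h /h /interior_normP. Qed.

Lemma closure_normP (A : set E) x :
  closure A x <-> forall e : R, 0 < e -> exists2 y, A y & `|x - y| < e.
Proof.
split=> [h e e0|h B /nbhs_normP[e /= e0 he]].
  have /h [y [Ay xy]] : nbhs x [set y | `|x - y| < e].
    by apply/nbhs_normP; exists e.
  by exists y.
by have [y Ay xy] := h e e0; exists y; split=> //; apply: he.
Qed.

Lemma closed_normP (A : set E) :
  (forall x, (forall e : R, 0 < e -> exists2 y, A y & `|x - y| < e) -> A x) ->
  closed A.
Proof. by move=> h x /closure_normP /h. Qed.

Lemma closed_notin (A : set E) x : closed A -> ~ A x ->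
  exists2 e : R, 0 < e & forall y, `|x - y| < e -> ~ A y.
Proof. by move=> cA; apply: open_normP; rewrite openC. Qed.

Lemma open_dist_ball (x : E) (e : R) : open [set y | `|y - x| < e].
Proof.
rewrite openE => y /= yx; apply/interior_normP.
exists (e - `|y - x|); first by rewrite subr_gt0.
move=> z; rewrite ltrBrDr distrC => zy; apply: le_lt_trans zy.
by rewrite -[z - x](subrKA y) ler_normD.
Qed.

End NormedTopology.

Section FiniteDimension.
Context (R : realType).

Lemma ler_rV_norm n (v : 'rV[R]_n) i : `|v 0 i| <= `|v|.
Proof.
rewrite [leRHS]/Num.norm /= mx_normrE.
exact: (@le_bigmax_cond _ _ _ _ (0, i) _ (fun ij => `|v ij.1 ij.2|)).
Qed.

Lemma lipschitz_continuous (E F : normedModType R) (f : E -> F) (K : R) :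
  (forall x y, `|f x - f y| <= K * `|x - y|) -> continuous f.
Proof.
move=> fK x; apply/cvgrPdist_lt => e e0.
have K1 : 0 < `|K| + 1 by rewrite ltr_pwDr.
apply/nbhs_normP; exists (e / (`|K| + 1)); first by rewrite /= divr_gt0.
move=> y /=; rewrite ltr_pdivlMr// => xy.
apply: le_lt_trans (fK _ _) _; apply: le_lt_trans xy.
by rewrite mulrC ler_wpM2l// ler_wpDr// ler_norm.
Qed.

(** Equivalence of norms: on the compact unit sphere of the coordinate space the norm of [E] has a
    positive minimum. *)
Lemma coord_bounded (E : finNormedModType R) : exists2 K : R, 0 < K &
  forall (x : E) i, `|coord (vbasis {:E}) i x| <= K * `|x|.
Proof.
pose n := \dim {:E}; pose e (i : 'I_n) : E := (vbasis {:E})`_i.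
have fe : free (vbasis {:E}) by apply: basis_free (vbasisP _).
pose g (v : 'rV[R]_n) : E := \sum_i v 0 i *: e i.
have gB v w : g v - g w = g (v - w).
  by rewrite -sumrB; apply: eq_bigr => i _; rewrite !mxE scalerBl.
have gZ c v : g (c *: v) = c *: g v.
  by rewrite scaler_sumr; apply: eq_bigr => i _; rewrite !mxE scalerA.
have cg : continuous (fun v => `|g v|).
  apply: (@lipschitz_continuous _ R^o _ (\sum_i `|e i|)) => v w.
  apply: le_trans (ler_dist_dist _ _) _; rewrite gB.
  apply: le_trans (ler_norm_sum _ _ _) _; rewrite mulr_suml.
  by apply: ler_sum => i _; rewrite normrZ mulrC ler_wpM2l// ler_rV_norm.
pose S := [set v : 'rV[R]_n | `|v| = 1].
have [c c0 hc] : exists2 c : R, 0 < c & forall v, c * `|v| <= `|g v|.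
  have [S0|S0] := pselect (S !=set0); last first.
    exists 1 => // v; have [->|v0] := eqVneq v 0; first by rewrite normr0 mulr0.
    case: S0; exists (`|v|^-1 *: v).
    by rewrite /S /= normrZ normfV normr_id mulVf// normr_eq0.
  have cS : compact S.
    apply: bounded_closed_compact.
      exists 1; split; first exact: num_real.
      by move=> M M1 v /= ->; exact: ltW.
    apply: closed_normP => v hv; apply/eqP; rewrite -subr_eq0 -normr_le0.
    apply/ler_addgt0Pr => _ /posnumP[d]; rewrite add0r.
    have [w <- vw] := hv _ [gt0 of d%:num].
    exact: le_trans (ler_dist_dist _ _) (ltW vw).
  have [v0 /set_mem Sv0 hv0] := compact_EVT_min S0 cS (continuous_subspaceT cg).
  exists `|g v0|.
    rewrite normr_gt0; apply/eqP => g0.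
    have : v0 = 0.
      by apply/rowP => i; rewrite mxE -(coord_sum_free (v0 0) i fe) -/(g v0) g0 linear0.
    by move=> v00; move: Sv0; rewrite /S /= v00 normr0 => /eqP; rewrite eq_sym oner_eq0.
  move=> v; have [->|vn] := eqVneq v 0; first by rewrite normr0 mulr0.
  have := hv0 (`|v|^-1 *: v); rewrite gZ normrZ normfV normr_id.
  rewrite mulrC ler_pdivlMr ?normr_gt0//; apply; apply/mem_set.
  by rewrite /S /= normrZ normfV normr_id mulVf// normr_eq0.
exists c^-1; first by rewrite invr_gt0.
move=> x i; pose v := \row_i coord (vbasis {:E}) i x.
have gv : g v = x.
  by rewrite [RHS](coord_vbasis (memvf x)); apply: eq_bigr => j _; rewrite mxE.
have := hc v; rewrite gv mulrC -ler_pdivlMr// mulrC; apply: le_trans.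
by have := ler_rV_norm v i; rewrite mxE.
Qed.

Lemma linear_lipschitz_fin (E : finNormedModType R) (F : normedModType R)
    (f : {linear E -> F}) :
  exists2 K : R, 0 < K & forall x, `|f x| <= K * `|x|.
Proof.
have [K K0 hK] := coord_bounded E.
exists (K * (1 + \sum_(i < \dim {:E}) `|f (vbasis {:E})`_i|)).
  by rewrite mulr_gt0// ltr_pwDl// sumr_ge0.
move=> x; rewrite {1}(coord_vbasis (memvf x)) linear_sum.
apply: le_trans (ler_norm_sum _ _ _) _.
apply: (@le_trans _ _ (\sum_(i < \dim {:E}) (K * `|x|) * `|f (vbasis {:E})`_i|)).
  by apply: ler_sum => i _; rewrite linearZ normrZ ler_wpM2r.
by rewrite -mulr_sumr [leRHS]mulrAC ler_wpM2l ?mulr_ge0 ?(ltW K0)// ler_wpDl.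
Qed.

Lemma linear_continuous_fin (E : finNormedModType R) (F : normedModType R)
    (f : {linear E -> F}) : continuous f.
Proof.
have [K _ hK] := linear_lipschitz_fin f.
by apply: (@lipschitz_continuous _ _ _ K) => x y; rewrite -linearB.
Qed.

End FiniteDimension.

(** * Pigeonhole and uniform constants over finite sets *)

Section Finiteness.

(** [N] depends on [D] alone, so constants uniform over the levels up to [N] can be chosen before
    the predicates [f] are known. *)
Lemma pigeonhole_on (T : Type) (D : set T) : finite_set D ->
  exists N, forall f : nat -> T -> Prop, exists i j, (i < j <= N)%N /\
    forall x, D x -> (f i x <-> f j x).
Proof.
move=> /finite_setP[n /card_set_bijP[g [gI ginj _]]].
exists (2 ^ n)%N => f.
pose h (i : 'I_(2 ^ n).+1) := [ffun k : 'I_n => `[< exists2 x, D x /\ g x = k & f i x >]].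
have /injectivePn[i [j ij hij]] : ~~ injectiveb h.
  apply/negP => /injectiveP /leq_card; rewrite card_ffun card_bool !card_ord.
  by rewrite ltnn.
wlog lt_ij : i j ij hij / (i < j)%N.
  move=> th; have [lt|gt|/val_inj eq] := ltngtP i j; first exact: th lt.
    by apply: th gt; rewrite // eq_sym.
  by rewrite eq eqxx in ij.
exists i, j; split; first by rewrite lt_ij -ltnS ltn_ord.
move=> x Dx; have /= gxn := gI _ Dx.
have hE k : h k (Ordinal gxn) <-> f k x.
  rewrite ffunE; split=> [/asboolP[y [Dy gy]]|fx]; last by apply/asboolP; exists x.
  by rewrite (ginj y x (mem_set Dy) (mem_set Dx) gy).
by rewrite -!hE hij.
Qed.

Lemma finite_min (R : realType) (T : Type) (D : set T) (P : T -> R -> Prop) :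
  finite_set D ->
  (forall x, D x -> exists2 e : R, 0 < e & P x e) ->
  (forall x e e', 0 < e' -> e' <= e -> P x e -> P x e') ->
  exists2 e : R, 0 < e & forall x, D x -> P x e.
Proof.
move=> fD h mono; have := fD => /finite_setP[n].
elim: n D fD h => [|n IH] D fD h.
  rewrite II0 card_eq0 => /eqP ->; by exists 1.
move=> /eq_cardSP[x Dx Dn]; have [e e0 Pe] := h x Dx.
have [|y [Dy _]|e' e'0 Pe'] := IH (D `\ x) _ _ Dn; first exact: finite_setD.
  exact: h.
exists (Num.min e e'); first by rewrite lt_min e0.
move=> y Dy; have [->|yx] := pselect (y = x).
  by apply: mono Pe; rewrite ?lt_min ?e0// ge_min lexx.
by apply: mono (Pe' y _); rewrite ?lt_min ?e0// ge_min lexx orbT.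
Qed.

End Finiteness.

Section Homomorphisms.
Context (R : realType) (U U' : finNormedModType R) (f : 'Hom(U, U')).

Lemma homD x y : f (x + y) = f x + f y. Proof. exact: linearD. Qed.

Lemma homB x y : f (x - y) = f x - f y. Proof. exact: linearB. Qed.

Lemma homN x : f (- x) = - f x. Proof. exact: linearN. Qed.

Lemma hom0 : f 0 = 0. Proof. exact: linear0. Qed.

Lemma homZ a x : f (a *: x) = a *: f x. Proof. exact: linearZ. Qed.

End Homomorphisms.

(** * Points in general position with respect to finitely many linear forms *)

Section Generic.
Context (R : realType).

Lemma itv_notin_countable (C : set R) (a b : R) :
  countable C -> a < b -> exists2 t, a < t < b & ~ C t.
Proof.
move=> cC ab; apply: contrapT => h.
have sub : `]a, b[%classic `<=` C.
  move=> t; rewrite /= in_itv /= => tab; apply: contrapT => Ct.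
  by apply: h; exists t.
have /countable_lebesgue_measure0 : countable `]a, b[%classic.
  by apply: sub_countable cC; exact: subset_card_le.
rewrite lebesgue_measure_itv /= lte_fin ab => /eqP.
by rewrite -EFinD eqe subr_eq0 gt_eqF.
Qed.

Lemma countable_preimage_affine (C : set R) (a b : R) : b != 0 ->
  countable C -> countable [set t | C (a + t * b)].
Proof.
move=> b0 cC; apply: sub_countable cC.
apply: card_le_trans (card_image_le (fun c => (c - a) / b) C).
apply: subset_card_le => t /= Ct; exists (a + t * b) => //.
by rewrite addrC addKr mulfK.
Qed.

Lemma countable_setU (T : Type) (A B : set T) :
  countable A -> countable B -> countable (A `|` B).
Proof.
move=> cA cB; rewrite -bigcup2E; apply: bigcup_countable => // -[|[|n]] _ //=.
Qed.

Lemma countable_exists (T : eqType) (s : seq T) (C : T -> set R) :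
  (forall x, countable (C x)) -> countable [set t | exists2 x, x \in s & C x t].
Proof.
move=> cC; apply: (@sub_countable _ _ _ (\bigcup_(x in [set` s]) C x)).
  by apply: subset_card_le => t [x xs Cx]; exists x.
by apply: bigcup_countable => // ; apply: finite_set_countable; exact: finite_seq.
Qed.

Context (V : finNormedModType R).
Implicit Types fs : seq 'Hom(V, R^o).

Lemma lfun_add_scale (f : 'Hom(V, R^o)) v t b : f (v + t *: b) = f v + t * f b.
Proof. by rewrite linearD linearZ. Qed.

Lemma lfunD (f : 'Hom(V, R^o)) x y : f (x + y) = f x + f y :> R.
Proof. exact: linearD. Qed.

Lemma lfunB (f : 'Hom(V, R^o)) x y : f (x - y) = f x - f y :> R.
Proof. exact: linearB. Qed.

(** Adding a multiple of [b'] to [b] spoils each form for at most one scalar, so only countably many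
    scalars have to be avoided. *)
Lemma ex_transversal fs : (forall f, f \in fs -> f != 0) ->
  exists b : V, forall f, f \in fs -> f b != 0.
Proof.
elim: fs => [|f fs IH] h; first by exists 0.
have [|b hb] := IH; first by move=> g gfs; apply: h; rewrite inE gfs orbT.
have [b' fb'] : exists b', f b' != 0.
  apply: contrapT => nex; move: (h f (mem_head _ _)) => /eqP; apply.
  apply/lfunP => v; rewrite lfunE /=; apply: contrapT => /eqP fv.
  by apply: nex; exists v.
pose C (g : 'Hom(V, R^o)) := [set t : R | g b' != 0 /\ g b + t * g b' = 0].
have cC g : countable (C g).
  have [g0|g0] := eqVneq (g b') 0.
    apply: (@sub_countable _ _ _ set0) => //; apply: subset_card_le => t [].
    by rewrite g0 eqxx.
  apply: (@sub_countable _ _ _ [set t | [set (0 : R)] (g b + t * g b')]).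
    by apply: subset_card_le => t [].
  exact: countable_preimage_affine.
have [t _ Ct] := itv_notin_countable (countable_exists (f :: fs) cC) ltr01.
exists (b + t *: b') => g gfs; rewrite lfun_add_scale; apply/eqP => g0.
have [gb'|gb'] := eqVneq (g b') 0.
  move: gfs; rewrite inE => /predU1P[gf|gfs]; first by rewrite -gf gb' eqxx in fb'.
  by have := hb g gfs; move: g0; rewrite gb' mulr0 addr0 => ->; rewrite eqxx.
by apply: Ct; exists g.
Qed.

(** Along a line in a transversal direction every form is a non-constant affine function and meets
    its forbidden values at countably many times. *)
Lemma ex_generic fs (C : 'Hom(V, R^o) -> set R) (O : set V) v0 :
  (forall f, f \in fs -> f != 0) -> (forall f, countable (C f)) ->
  open O -> O v0 -> exists2 v, O v & forall f, f \in fs -> ~ C f (f v).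
Proof.
move=> fs0 cC /open_normP /[apply] -[e e0 he].
have [b hb] := ex_transversal fs0.
pose C' (f : 'Hom(V, R^o)) := [set t : R | f b != 0 /\ C f (f v0 + t * f b)].
have cC' f : countable (C' f).
  have [f0|f0] := eqVneq (f b) 0.
    apply: (@sub_countable _ _ _ set0) => //; apply: subset_card_le => t [].
    by rewrite f0 eqxx.
  apply: (@sub_countable _ _ _ [set t | C f (f v0 + t * f b)]).
    by apply: subset_card_le => t [].
  exact: countable_preimage_affine.
have b1 : 0 < `|b| + 1 by rewrite ltr_pwDr.
have [|t /andP[t0 te] Ct] := itv_notin_countable (a := 0) (b := e / (`|b| + 1))
  (countable_exists fs cC'); first exact: divr_gt0.
exists (v0 + t *: b).
  apply: he; rewrite opprD addNKr normrN normrZ gtr0_norm//.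
  apply: (@le_lt_trans _ _ (t * (`|b| + 1))); first by rewrite ler_wpM2l ?ltW// ltrDl.
  by rewrite -ltr_pdivlMr.
move=> f ffs Cf; apply: Ct; exists f => //; split; first exact: hb.
by rewrite -lfun_add_scale.
Qed.

(** Off its boundary [A] coincides with its interior, so its trace on the connected segment is both
    open and closed. *)
Lemma segment_boundary (A : set V) (x y : V) : closed A ->
  (forall t : R, 0 <= t <= 1 -> ~ boundary A (x + t *: (y - x))) ->
  A x -> A y.
Proof.
move=> cA h Ax; pose g (t : R) := x + t *: (y - x).
have cg : continuous (g : R^o -> V).
  apply: (@lipschitz_continuous _ R^o _ _ `|y - x|) => s t.
  by rewrite /g opprD addrACA subrr add0r -scalerBl normrZ mulrC.
have /= conn := @segment_connected R 0 1.
have <- : g 1 = y by rewrite /g scale1r subrKC.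
suff B : `[0, 1]%classic `&` g @^-1` A = `[0, 1]%classic.
  have : (`[0, 1]%classic `&` g @^-1` A) 1 by rewrite B /= in_itv /= ler01 lexx.
  by case.
apply: conn.
- exists 0; split; first by rewrite /= in_itv /= ler01 lexx.
  by rewrite /= /g scale0r addr0.
- exists (g @^-1` A°); first by apply: open_comp => [t _|]; [exact: cg|exact: open_interior].
  apply/seteqP; split=> t [t01 At]; split=> //.
    apply: contrapT => nA; move: t01; rewrite /= in_itv /= => /h; apply.
    by split=> //; exact: subset_closure.
  exact: (interior_subset (A := A) (t := g t)).
- exists (g @^-1` A) => //.
  by apply: preimage_closed => [t _|]; [exact: cg|exact: cA].
Qed.

End Generic.

(** * Model sets over an abstract lattice: parameters, hull and minimality *)

Section ModelSets.
Context (R : realType) (X V : finNormedModType R) (G : zmodType).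
Context (p : {additive G -> X}) (q : {additive G -> V}).
Hypothesis lattice_finite :
  forall r : R, finite_set [set g | `|p g| <= r /\ `|q g| <= r].
Hypothesis p_inj : injective p.
(** Density made uniform: [r] depends on the open set only, not on the physical position [x] or the
    internal shift [w]. *)
Hypothesis lattice_dense : forall O : set V, open O -> O !=set0 ->
  exists r : R, forall x w, exists2 g, `|p g - x| <= r & O (q g + w).
Context (l : nat) (W : colored V l) (B : R).
Hypothesis W_closed : forall i, closed (W i).
Hypothesis W_regular : forall i, W i `<=` closure (W i)°.
Hypothesis W_bounded : forall i x, W i x -> `|x| <= B.
Hypothesis W_nonempty : exists i, (W i)° !=set0.

Definition model (a : X) (w : V) : colored X l :=
  fun i => [set p g + a | g in [set g | W i (q g + w)]].

Definition nonsing (w : V) := forall i g, ~ boundary (W i) (q g + w).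

(** [P] lies between the model sets of the open and of the closed window, which is what survives a
    limit at a singular parameter. *)
Definition sandwich (P : colored X l) (a : X) (w : V) :=
  (forall i y, P i y -> exists2 g, y = p g + a & W i (q g + w)) /\
  (forall i g, (W i)° (q g + w) -> P i (p g + a)).

(* [P] is a limit of non-singular model sets in the fibre of [a]: the torus
   parameter of [P] is the class of [a + w] (see [torus_approx]). *)
Definition approx (P : colored X l) (a : X) (w : V) :=
  forall r e : R, 0 < e -> exists w',
    [/\ nonsing w', `|w' - w| < e & agree r P 0 (model a w') 0].

Definition in_hull (P : colored X l) :=
  delone P /\ exists2 w, nonsing w & LI P (model 0 w).

Lemma modelE a w i g : model a w i (p g + a) <-> W i (q g + w).
Proof.
split=> [[g' Wg' /addIr /p_inj <-]//|Wg]; by exists g.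
Qed.

Lemma model_shift a w g : model (a + p g) (w + q g) = model a w.
Proof.
apply: colored_ext => i y; split=> -[h Wh <-].
  by exists (h + g); rewrite /= ?raddfD /= addrAC -addrA // [_ + a]addrC addrA.
by exists (h - g); rewrite /= raddfB /= ?[a + _]addrC ?[w + _]addrC addrA subrK.
Qed.

Lemma nonsing_shift w g : nonsing w -> nonsing (w + q g).
Proof. by move=> nw i h; rewrite addrCA -raddfD addrC; exact: nw. Qed.

Lemma agree_model_translate a t w r x :
  agree r (model (a + t) w) (x + t) (model a w) x.
Proof.
move=> s i _; split=> -[g Wg e]; exists g => //.
  by apply: (addIr t); rewrite -addrA e addrAC.
by rewrite addrA e addrAC.
Qed.

Lemma approx_translate P a w t :
  approx P a w -> approx (translate P t) (a + t) w.
Proof.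
move=> h r e /(h (`|t| + r)) [w' [nw ww ag]]; exists w'; split=> //.
apply/agree_translatel; rewrite sub0r.
have := @agree_shift _ _ _ _ r (- t) _ _ _ _ _ ag; rewrite normrN add0r.
move=> h1; apply: agree_trans (h1 (lexx _)) _; apply: agree_sym.
by have := @agree_model_translate a t w' r (- t); rewrite addNr.
Qed.

Lemma approx_shift P a w g : approx P a w -> approx P (a + p g) (w + q g).
Proof.
move=> h r e /(h r) [w' [nw ww ag]]; exists (w' + q g); split.
- exact: nonsing_shift.
- by rewrite opprD addrACA subrr addr0.
- by rewrite model_shift.
Qed.

Lemma sandwich_shift P a w g :
  sandwich P a w -> sandwich P (a + p g) (w + q g).
Proof.
move=> [h1 h2]; split=> [i y /h1[h -> Wh]|i h].
  exists (h - g); first by rewrite raddfB [a + _]addrC addrA subrK.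
  by rewrite raddfB [w + _]addrC addrA subrK.
rewrite addrCA [q h + _]addrC [w + _]addrC -raddfD => /h2.
by rewrite raddfD -addrA addrC -addrA.
Qed.

Lemma sandwich_model a w : sandwich (model a w) a w.
Proof.
split=> [i y [g Wg <-]|i g /interior_subset Wg]; first by exists g.
exact/modelE.
Qed.

Lemma approx_model a w : nonsing w -> approx (model a w) a w.
Proof. by move=> nw r e e0; exists w; rewrite subrr normr0. Qed.

Lemma approx_sandwich P a w : approx P a w -> sandwich P a w.
Proof.
move=> h; split=> [i y Py|i g /interior_normP[e e0 he]].
  have [w' [_ _ ag]] := h `|y| 1 ltr01.
  have [g _ yE] : model a w' i y.
    by rewrite -[y]add0r; apply/(ag y i (lexx _)); rewrite add0r.
  exists g => //; apply: W_closed; apply/closure_normP => e e0.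
  have [w2 [_ w2w ag2]] := h `|y| e e0.
  exists (q g + w2); last by rewrite opprD addrACA subrr add0r distrC.
  apply/(modelE a); rewrite yE -[y]add0r; apply/(ag2 y i (lexx _)).
  by rewrite add0r.
have [w' [_ ww ag]] := h `|p g + a| e e0.
rewrite -[p g + a]add0r; apply/(ag _ i (lexx _)); rewrite add0r.
by apply/modelE; apply: he; rewrite opprD addrACA subrr add0r distrC.
Qed.

Lemma lattice_near_finite a w r s :
  finite_set [set g | `|p g + a| <= r /\ `|q g + w| <= s].
Proof.
apply: sub_finite_set (lattice_finite (Num.max (r + `|a|) (s + `|w|))) => g [h1 h2].
have ineq (E : normedModType R) (x y : E) t : `|x + y| <= t -> `|x| <= t + `|y|.
  by move=> h; rewrite -[x](addrK y) (le_trans (ler_normB _ _))// lerD2r.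
by split; rewrite le_max (ineq _ _ _ _ h1, ineq _ _ _ _ h2) ?orbT.
Qed.

(** Finitely many lattice points matter for a ball of radius [r]. At a non-singular [w] each
    projects into an interior or outside a closed window, with room to spare. The bound [B + 1]
    admits all parameters within distance 1 of [w]. *)
Lemma sandwich_locally_constant a w r : nonsing w ->
  exists2 e : R, 0 < e & forall w' P, `|w' - w| < e -> sandwich P a w' ->
    agree r P 0 (model a w) 0.
Proof.
move=> nw.
have [|||e e0 he] := @finite_min R G [set g | `|p g + a| <= r /\ `|q g + w| <= B + 1]
  (fun g e => forall i y, `|q g + w - y| < e ->
     (W i y -> W i (q g + w)) /\ (W i (q g + w) -> (W i)° y)).
- exact: lattice_near_finite.
- move=> g _.
  have [|||e e0 he] := @finite_min R 'I_l [set: 'I_l]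
    (fun i e => forall y, `|q g + w - y| < e ->
     (W i y -> W i (q g + w)) /\ (W i (q g + w) -> (W i)° y)).
  + exact: finite_finset.
  + move=> i _; have [Wi|Wi] := pselect (W i (q g + w)).
      have : (W i)° (q g + w).
        apply: contrapT => nWi; apply: (nw i g); split=> //.
        exact: subset_closure.
      move=> /(open_normP (open_interior _)) [e e0 he]; exists e => // y /he.
      by [].
    have [e e0 he] := closed_notin (@W_closed i) Wi.
    by exists e => // y /he.
  + by move=> i e1 e2 _ e21 h y /lt_le_trans /(_ e21) /h.
  + by exists e => // i y; exact: he.
- by move=> g e1 e2 _ e21 h i y /lt_le_trans /(_ e21) /h.
exists (Num.min e 1); first by rewrite lt_min e0 /=.
move=> w' P; rewrite lt_min => /andP[we w1] [h1 h2] s i sr; rewrite add0r.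
have d g : `|q g + w - (q g + w')| = `|w' - w|.
  by rewrite opprD addrACA subrr add0r distrC.
split=> [/h1[g sE Wg]|[g Wg sE]].
  exists g => //; have Dg : `|p g + a| <= r /\ `|q g + w| <= B + 1.
    rewrite -sE; split=> //; rewrite -[q g + w](subrK (q g + w')).
    apply: (le_trans (ler_normD _ _)); rewrite addrC lerD ?(W_bounded Wg)//.
    by rewrite d ltW.
  by have := he g Dg i (q g + w'); rewrite d => /(_ we) [+ _]; exact.
have Dg : `|p g + a| <= r /\ `|q g + w| <= B + 1.
  by rewrite sE; split=> //; rewrite (le_trans (W_bounded Wg))// lerDl.
rewrite -sE; apply: h2.
by have := he g Dg i (q g + w'); rewrite d => /(_ we) [_]; exact.
Qed.

(** Differences of points come from lattice elements with internal part at most [B + B]. Finitely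
    many of these are short, and [p] is injective. *)
Lemma delone_model a w : delone (model a w).
Proof.
split.
  have [|||e e0 he] := @finite_min R G [set g | `|p g + 0| <= 1 /\ `|q g + 0| <= B + B]
    (fun g e => g != 0 -> e <= `|p g|).
  - exact: lattice_near_finite.
  - move=> g _; have [->|g0] := eqVneq g 0; first by exists 1.
    exists `|p g| => //; rewrite normr_gt0; apply: contra g0 => /eqP pg.
    by apply/eqP/p_inj; rewrite raddf0.
  - by move=> g e1 e2 _ + h; move=> + /h; exact: le_trans.
  exists (Num.min e 1); first by rewrite lt_min e0 /=.
  move=> _ _ [i _ [g Wg <-]] [j _ [h Wh <-]]; rewrite opprD addrACA subrr addr0.
  rewrite (inj_eq (@addIr _ _)) -raddfB (inj_eq p_inj) -subr_eq0 => gh.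
  have [gh1|gh1] := leP `|p (g - h)| 1; last by rewrite ge_min (ltW gh1) orbT.
  rewrite ge_min he//; split; rewrite /= addr0//.
  have -> : q (g - h) = q g + w - (q h + w) by rewrite opprD addrACA subrr addr0 -raddfB.
  by rewrite (le_trans (ler_normB _ _))// lerD// (W_bounded Wg, W_bounded Wh).
have [i0 Wi0] := W_nonempty.
have [r hr] := lattice_dense (@open_interior _ (W i0)) Wi0.
exists r => x; have [g gx /interior_subset Wg] := hr (x - a) w.
exists (p g + a); first by exists i0 => //; exists g.
by move: gx; rewrite opprB distrC -addrA.
Qed.

Lemma model_in_hull a w : nonsing w -> in_hull (model a w).
Proof.
move=> nw; split; first exact: delone_model.
exists w => //; apply/LIP => r; exists (- a).
apply: agree_sym; have := @agree_model_translate a (- a) w r 0.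
by rewrite subrr add0r.
Qed.

Lemma in_hull_LI P Q : in_hull P -> LI Q P -> in_hull Q.
Proof.
move=> [dP [w nw PL]] QP; split; first exact: delone_LI dP.
by exists w => //; exact: LI_trans PL.
Qed.

(** A patch of one non-singular model set recurs within distance [rho] of every position of the
    other, hence inside any copied ball of radius [rho + r]. *)
Lemma hull_minimal P Q : in_hull P -> in_hull Q -> LI P Q.
Proof.
move=> [_ [w nw PL]] [_ [w' nw' QL]]; apply: LI_trans PL _.
apply/LIP => r; have [e e0 he] := sandwich_locally_constant 0 r nw.
have [||rho hrho] := lattice_dense (O := [set v | `|v - w| < e]).
- exact: open_dist_ball.
- by exists w; rewrite /= subrr normr0.
have /LIP /(_ (rho + r)) [t ht] := QL.
have [g gt gw] := hrho t w'; exists (p g - t).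
apply: agree_sym; apply: (@agree_trans _ _ _ _ _ (model 0 w') _ _ (p g)).
  have := @agree_shift _ _ _ _ r (p g - t) _ _ _ _ _ ht; rewrite add0r subrKC; apply.
  by rewrite lerD2r.
rewrite -(model_shift _ _ g) add0r.
apply: (@agree_trans _ _ _ _ _ (model 0 (q g + w')) _ _ 0).
  have := @agree_model_translate 0 (p g) (w' + q g) r 0; rewrite !add0r.
  by rewrite [q g + _]addrC.
by apply: he gw _; exact: sandwich_model.
Qed.

(** Take a point of [P] whose internal image maximises [f] on a window up to [e]. If it belongs to
    [Q] too, the image shifted by [w' - w] is still in the window, so [f] cannot have grown by more
    than [e]. Such points occur within a radius that does not depend on the patterns. *)
Lemma lfun_shift_bound (f : 'Hom(V, R^o)) (e : R) : 0 < e ->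
  exists r, forall P Q a w w', sandwich P a w -> sandwich Q a w' ->
    agree r P 0 Q 0 -> f (w' - w) <= e.
Proof.
move=> e0; have [i [v0 v0W]] := W_nonempty.
have [K K0 hK] := @linear_lipschitz_fin R V R^o f.
pose A := [set f v | v in W i]; pose M := sup A.
have supA : has_sup A.
  split; first by exists (f v0); exists v0 => //; exact: interior_subset.
  exists (K * B) => _ [v Wv <-]; apply: le_trans (ler_norm _) _.
  by apply: le_trans (hK v) _; rewrite ler_pM2l// (W_bounded Wv).
have [_ [v Wv <-] Mv] := sup_adherent e0 supA.
have cf : continuous (f : V -> R) by exact: (@linear_continuous_fin R V R^o f).
pose O := (W i)° `&` f @^-1` [set t | M - e < t].
have oO : open O.
  apply: openI; first exact: open_interior.
  by apply: open_comp => [t _|]; [exact: cf|exact: open_gt].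
have [|r hr] := lattice_dense oO.
  have oM : open (f @^-1` [set t | M - e < t]).
    by apply: open_comp => [t _|]; [exact: cf|exact: open_gt].
  have [d d0 hd] := open_normP oM Mv.
  have /closure_normP /(_ d d0) [u Wu /hd fu] := W_regular Wv.
  by exists u.
exists r => P Q a w w' [_ PW] [QW _] PQ.
have [g gr [Wg fg]] := hr (- a) w; rewrite opprK in gr.
have [g' gg' Wg'] : exists2 g', p g + a = p g' + a & W i (q g' + w').
  by apply: QW; rewrite -[p g + a]add0r; apply/(PQ _ i gr); rewrite add0r; exact: PW.
move: gg' Wg' => /addIr /p_inj <- Wg'.
have : f (q g + w') <= M by apply: sup_upper_bound => //; exists (q g + w').
move: fg; rewrite /= (_ : w' - w = (q g + w') - (q g + w)) ?lfunB.
  by lra.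
by rewrite opprD addrACA subrr add0r.
Qed.

Lemma norm_shift_bound (e : R) : 0 < e ->
  exists r, forall P Q a w w', sandwich P a w -> sandwich Q a w' ->
    agree r P 0 Q 0 -> `|w' - w| < e.
Proof.
move=> e0; pose n := \dim {:V}; pose b (k : 'I_n) : V := (vbasis {:V})`_k.
pose s := 1 + \sum_k `|b k|.
have s0 : 0 < s by rewrite ltr_pwDl// sumr_ge0.
have d0 : 0 < e / s / 2 by rewrite !divr_gt0.
pose f (k : 'I_n) : 'Hom(V, R^o) := linfun (coord (vbasis {:V}) k : V -> R^o).
have /choice[r hr] : forall k, exists r, forall P Q a w w',
    sandwich P a w -> sandwich Q a w' -> agree r P 0 Q 0 ->
    `|coord (vbasis {:V}) k (w' - w)| <= e / s / 2.
  move=> k; have [r hr] := lfun_shift_bound (f k) d0.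
  have [r' hr'] := lfun_shift_bound (- f k) d0.
  exists (Num.max r r') => P Q a w w' Pw Qw' PQ; rewrite ler_norml.
  have := hr P Q a w w' Pw Qw'; rewrite lfunE /= => -> //.
    have := hr' P Q a w w' Pw Qw'; rewrite !lfunE /= lfunE /= lerNl => -> //.
    by apply: agree_le PQ; rewrite le_max lexx orbT.
  by apply: agree_le PQ; rewrite le_max lexx.
exists (\sum_k `|r k|) => P Q a w w' Pw Qw' PQ.
rewrite (coord_vbasis (memvf (w' - w))); apply: le_lt_trans (ler_norm_sum _ _ _) _.
apply: (@le_lt_trans _ _ (\sum_k (e / s / 2) * `|b k|)).
  apply: ler_sum => k _; rewrite normrZ ler_wpM2r//.
  apply: hr Pw Qw' _; apply: agree_le PQ; apply: le_trans (ler_norm _) _.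
  by rewrite (bigD1 k)//= lerDl sumr_ge0.
rewrite -mulr_sumr.
apply: (@lt_le_trans _ _ (e / s / 2 * s)); first by rewrite ltr_pM2l// ltrDr.
by rewrite mulrAC divfK ?gt_eqF// ler_pdivrMr// mulr_natr mulr2n lerDl ltW.
Qed.

(** A common point is both [p g1 + a] and [p g2 + a'], so the physical parameters differ by a
    lattice projection. After that shift only internal parts remain to be compared. *)
Lemma agree_close (e : R) : 0 < e ->
  exists r, forall r', r <= r' -> forall P Q a w a' w',
    (exists i x, P i x /\ `|x| <= r') ->
    sandwich P a w -> sandwich Q a' w' ->
    agree r' P 0 Q 0 -> exists2 g, a = a' + p g & `|w' + q g - w| < e.
Proof.
move=> /norm_shift_bound[r hr]; exists r => r' rr' P Q a w a' w'.
move=> [i [x [Px xr]]] Pw Qw' PQ.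
have [g1 xE _] := Pw.1 _ _ Px.
have [g2 xE' _] : exists2 g, x = p g + a' & W i (q g + w').
  by apply: Qw'.1; rewrite -[x]add0r; apply/(PQ _ i xr); rewrite add0r.
have aE : a = a' + p (g2 - g1).
  by rewrite raddfB addrA [a' + _]addrC -xE' xE addrC addKr.
exists (g2 - g1) => //; apply: hr Pw _ (agree_le rr' PQ); rewrite aE.
exact: sandwich_shift.
Qed.

(** * Patches and the cells of the hyperplane arrangement *)

Section Hyperplanes.
Context (Hs : seq ('Hom(V, R^o) * R)).
Hypothesis W_boundary : forall i x, boundary (W i) x ->
  exists2 h, h \in Hs & h.1 x = h.2.

Lemma same_sign_convex (t x y : R) : 0 <= t <= 1 -> 0 < x * y ->
  x + t * (y - x) != 0.
Proof.
move=> /andP[t0 t1] xy; apply/eqP => e.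
have y0 : 0 < y * y.
  rewrite -expr2 lt_def sqr_ge0 andbT expf_eq0 /=; apply/eqP => y0.
  by move: xy; rewrite y0 mulr0 ltxx.
have e2 : (1 - t) * (x * y) + t * (y * y) = 0.
  by rewrite -[RHS](mul0r y) -e; ring.
have h1 : 0 <= (1 - t) * (x * y) by rewrite mulr_ge0 ?subr_ge0// ltW.
have h2 : 0 <= t * (y * y) by rewrite mulr_ge0// ltW.
have h3 : (1 - t) * (x * y) = 0 by lra.
have h4 : t * (y * y) = 0 by lra.
move/eqP: h4; rewrite mulf_eq0 (gt_eqF y0) orbF => /eqP t00.
by move: h3; rewrite t00 subr0 mul1r => h3; rewrite h3 ltxx in xy.
Qed.

Lemma convex_combE (E : lmodType R) (t : R) (x y : E) :
  x + t *: (y - x) = (1 - t) *: x + t *: y.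
Proof. by rewrite scalerBr scalerBl scale1r addrAC addrA addrAC. Qed.

(** On the way from [w1] to [w2] a lattice point can enter or leave a window only by crossing a
    hyperplane. Close to [w] only hyperplanes through [q g + w] can be met, and these do not
    separate the two ends. *)
Lemma agree_cells a w r : exists2 e : R, 0 < e & forall w1 w2,
  `|w1 - w| < e -> `|w2 - w| < e ->
  (forall g i h, `|p g + a| <= r -> W i (q g + w) -> h \in Hs ->
     h.1 (q g + w) = h.2 -> 0 < h.1 (w1 - w) * h.1 (w2 - w)) ->
  agree r (model a w1) 0 (model a w2) 0.
Proof.
pose D := [set g | `|p g + a| <= r /\ `|q g + w| <= B + 1].
have [|||e e0 he] := @finite_min R G D
  (fun g e => forall y, `|q g + w - y| < e ->
     (forall i, W i y -> W i (q g + w)) /\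
     (forall h, h \in Hs -> h.1 y = h.2 -> h.1 (q g + w) = h.2)).
- exact: lattice_near_finite.
- move=> g _.
  have [|||e e0 he] := @finite_min R 'I_l [set: 'I_l]
    (fun i e => forall y, `|q g + w - y| < e -> W i y -> W i (q g + w)).
  + exact: finite_finset.
  + move=> i _; have [Wi|Wi] := pselect (W i (q g + w)); first by exists 1.
    by have [e e0 he] := closed_notin (@W_closed i) Wi; exists e => // y /he.
  + by move=> i e1 e2 _ e21 h y /lt_le_trans /(_ e21) /h.
  have [|||e' e'0 he'] := @finite_min R _ [set` Hs]
    (fun h e => forall y, `|q g + w - y| < e -> h.1 y = h.2 -> h.1 (q g + w) = h.2).
  + exact: finite_seq.
  + move=> h _; have [hE|hE] := eqVneq (h.1 (q g + w)) h.2; first by exists 1.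
    have oO : open (h.1 @^-1` [set t : R^o | t != h.2]).
      apply: open_comp => [t _|]; last exact: open_neq.
      exact: (@linear_continuous_fin R V R^o h.1).
    have [e' e'0 he'] := open_normP oO hE.
    by exists e' => // y /he' /= /eqP.
  + by move=> i e1 e2 _ e21 h y /lt_le_trans /(_ e21) /h.
  exists (Num.min e e'); first by rewrite lt_min e0.
  move=> y; rewrite lt_min => /andP[ye ye']; split=> [i|h hHs]; first exact: he ye.
  exact: he' ye'.
- by move=> g e1 e2 _ e21 h y /lt_le_trans /(_ e21) /h.
exists (Num.min e 1); first by rewrite lt_min e0 /=.
have half w1 w2 : `|w1 - w| < Num.min e 1 -> `|w2 - w| < Num.min e 1 ->
    (forall g i h, `|p g + a| <= r -> W i (q g + w) -> h \in Hs ->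
       h.1 (q g + w) = h.2 -> 0 < h.1 (w1 - w) * h.1 (w2 - w)) ->
    forall s i, `|s| <= r -> model a w1 i s -> model a w2 i s.
  rewrite !lt_min => /andP[w1e w11] /andP[w2e _] sgn s i sr [g Wg sE].
  exists g => //; have gr : `|p g + a| <= r by rewrite sE.
  have d v : q g + w - (q g + v) = w - v by rewrite opprD addrACA subrr add0r.
  have Dg : D g.
    split=> //; rewrite -[q g + w](subrK (q g + w1)).
    apply: (le_trans (ler_normD _ _)); rewrite addrC lerD ?(W_bounded Wg)//.
    by rewrite d distrC ltW.
  have Wgw : W i (q g + w).
    by have := he g Dg (q g + w1); rewrite d distrC => /(_ w1e) [/(_ i Wg)].
  apply: (@segment_boundary _ _ (W i) (q g + w1)) => // t t01 /W_boundary[h hHs].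
  set z := _ + t *: _ => hz.
  have zE : z = q g + (w1 + t *: (w2 - w1)).
    by rewrite /z opprD addrACA subrr add0r addrA.
  have zw : w1 + t *: (w2 - w1) - w = (w1 - w) + t *: (w2 - w - (w1 - w)).
    by rewrite opprB addrA subrK addrAC.
  have ze : `|q g + w - z| < e.
    rewrite zE d distrC zw convex_combE.
    have /andP[t0 t1] := t01.
    apply: le_lt_trans (ler_normD _ _) _; rewrite !normrZ [`|t|]ger0_norm//.
    rewrite ger0_norm; last by rewrite subr_ge0.
    set u := `|w1 - w|; set v := `|w2 - w|.
    apply: (@le_lt_trans _ _ (Num.max u v)); last by rewrite gt_max w1e.
    have : u <= Num.max u v by rewrite le_max lexx.
    have : v <= Num.max u v by rewrite le_max lexx orbT.
    nra.
  have [_ /(_ h hHs hz) hw] := he g Dg z ze.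
  have := same_sign_convex t01 (sgn g i h gr Wgw hHs hw).
  have -> : h.1 (w2 - w) - h.1 (w1 - w) = h.1 (w2 - w - (w1 - w)).
    exact/esym/lfunB.
  rewrite -lfun_add_scale -zw.
  have -> : w1 + t *: (w2 - w1) - w = z - (q g + w).
    by rewrite zE opprD addrACA subrr add0r.
  by rewrite lfunB hz hw subrr eqxx.
move=> w1 w2 w1e w2e sgn s i sr; rewrite add0r; split; apply: half => //.
by move=> g j h gr Wg hHs hw; rewrite mulrC; exact: (sgn g j).
Qed.

End Hyperplanes.

(** * Substitutions on the hull and their action on parameters *)

Section LocalMaps.
Context (F : 'End(X)).
Hypothesis F_auto : automorphism F.

Let FK : cancel F F^-1%VF. Proof. exact: lker0_lfunK. Qed.

Let FVK : cancel F^-1%VF F. Proof. exact: lker0_lfunVK. Qed.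

Definition local_map (sigma : colored X l -> colored X l) :=
  (forall Q, in_hull Q -> in_hull (sigma Q)) /\
  exists2 c : R, 0 <= c & forall Q Q', in_hull Q -> in_hull Q' ->
    forall x y, agree c Q x Q' y ->
    forall i, sigma Q i (F x) <-> sigma Q' i (F y).

Lemma agree_lin_image (r : R) : exists r', forall Q Q' x y,
  agree r' Q x Q' y -> agree r (lin_image F Q) (F x) (@lin_image R X l F Q') (F y).
Proof.
have [K K0 hK] := @linear_lipschitz_fin R X X F^-1%VF.
exists (K * r) => Q Q' x y h s i sr.
rewrite -[s]FVK -!homD !lin_imageE; try exact: can_inj FK.
by apply: h; apply: le_trans (hK s) _; rewrite ler_pM2l.
Qed.

Lemma LI_lin_image (P Q : colored X l) :
  LI P Q -> LI (lin_image F P) (lin_image F Q).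
Proof.
move=> PQ; apply/LIP => r; have [r' hr'] := agree_lin_image r.
have [t ht] := (LIP _ _).1 PQ r'; exists (F t).
by have := hr' _ _ _ _ ht; rewrite hom0.
Qed.

Lemma substitution_local_map sigma :
  substitution_map in_hull F sigma -> local_map sigma.
Proof.
move=> [S [SO [c c0 Sc]] sE]; split=> [Q hQ|].
  by rewrite sE//; apply: SO; exists Q.
have [c' hc'] := agree_lin_image c.
exists `|c'| => // Q Q' hQ hQ' x y xy i; rewrite !sE//.
have /central_patchP : central_patch (S (lin_image F Q)) (F x) 0 =
    central_patch (S (lin_image F Q')) (F y) 0.
  apply: Sc; [by exists Q|by exists Q'|]; apply/central_patchP/hc'.
  by apply: agree_le xy; exact: ler_norm.
by move=> /(_ 0 i); rewrite normr0 !addr0; exact.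
Qed.

(** By minimality every patch of an image [lin_image F Q] occurs in that of [P']. So the rule
    applies on the whole hull: a point is coloured as [P] is at any place with the same
    surroundings. *)
Lemma LD_substitution P P' : in_hull P -> in_hull P' ->
  LD P (lin_image F P') ->
  exists2 sigma, substitution_map in_hull F sigma & sigma P' = P.
Proof.
move=> hP hP' /LDP[c c0 rule].
pose S (Q : colored X l) : colored X l :=
  fun i => [set x | exists2 y, agree c Q x (lin_image F P') y & P i y].
have SE Q x y i : agree c Q x (lin_image F P') y -> S Q i x <-> P i y.
  move=> xy; split=> [[z xz Pz]|Py]; last by exists y.
  by apply/(rule y z) => //; apply: agree_trans xz; exact: agree_sym.
have S_LI Q : in_hull Q -> LI (S (lin_image F Q)) P.
  move=> hQ; apply/LIP => r.
  have [y yc] := LI_at (r + c) 0 (LI_lin_image (hull_minimal hQ hP')).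
  exists y => s i sr; apply: SE; apply: agree_shift yc.
  by rewrite lerD2r.
exists (fun Q => S (lin_image F Q)).
  exists S => //; split=> [_ [Q hQ <-]|]; first exact: in_hull_LI hP (S_LI Q hQ).
  exists c => // _ _ [Q hQ <-] [Q' hQ' <-] x y /central_patchP xy.
  apply/central_patchP => s i; rewrite normr_le0 => /eqP ->; rewrite !addr0.
  have [z xz] := LI_at c x (LI_lin_image (hull_minimal hQ hP')).
  rewrite (SE _ _ z)//; apply: iff_sym; apply: SE.
  by apply: agree_trans xz; exact: agree_sym.
by apply: colored_ext => i x; exact: SE.
Qed.

Lemma local_map_agree sigma : local_map sigma ->
  forall r : R, exists r', forall Q Q', in_hull Q -> in_hull Q' ->
  forall x y, agree r' Q x Q' y -> agree r (sigma Q) (F x) (sigma Q') (F y).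
Proof.
move=> [_ [c c0 hc]] r; have [K K0 hK] := @linear_lipschitz_fin R X X F^-1%VF.
exists (K * r + c) => Q Q' hQ hQ' x y xy s i sr.
rewrite -[s]FVK -!homD; apply: hc => //; apply: agree_shift xy.
by rewrite lerD2r; apply: le_trans (hK s) _; rewrite ler_pM2l.
Qed.

Lemma local_map_translate sigma Q t : local_map sigma -> in_hull Q ->
  sigma (translate Q t) = translate (sigma Q) (F t).
Proof.
move=> [sH [c c0 hc]] hQ; apply: colored_ext => i x; rewrite translateE.
rewrite -[x]FVK -homB; apply: hc => //; last first.
  by apply/agree_translatel; exact: agree_refl.
apply: in_hull_LI hQ _; apply/LIP => r; exists (- t).
by apply/agree_translatel; rewrite sub0r; exact: agree_refl.
Qed.

Context (A : 'End(V)) (m : G -> G).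
Hypothesis p_m : forall g, p (m g) = F (p g).
Hypothesis q_m : forall g, q (m g) = A (q g).

(** The affine action on parameters, with vectors in place of torus classes so that translation
    parts of iterates can be computed. *)
Definition lifts sigma (b : X) (k : V) := forall Q a w,
  in_hull Q -> approx Q a w -> approx (sigma Q) (F a + b) (A w + k).

(** The image of one parameter determines the affine map. Any [Q] agrees on a large ball with a
    translate of [Q0], so the two parameters are close modulo the lattice; locality of [sigma] and
    [m] carry this to the images. *)
Lemma local_map_lifts sigma Q0 a0 w0 a1 w1 : local_map sigma ->
  in_hull Q0 -> approx Q0 a0 w0 -> approx (sigma Q0) a1 w1 ->
  lifts sigma (a1 - F a0) (w1 - A w0).
Proof.
move=> loc h0 ap0 ap1 Q a w hQ apQ r e e0.
have [r' hr'] := local_map_agree loc r.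
have [K K0 hK] := @linear_lipschitz_fin R V V A.
have e'0 : 0 < e / 2 / K by rewrite !divr_gt0.
have [r2 hr2] := agree_close e'0.
have [[_ [rd hrd]] _] := hQ.
have [x [i _ Qx] xrd] := hrd 0; rewrite sub0r normrN in xrd.
pose R1 := Num.max r' (Num.max r2 rd).
have [t ht] := (LIP _ _).1 (hull_minimal hQ h0) R1.
have [|||||g aE wE] := hr2 R1 _ Q (translate Q0 (- t)) a w (a0 - t) w0.
- by rewrite !le_max lexx orbT.
- by exists i, x; split=> //; rewrite !le_max xrd !orbT.
- exact: approx_sandwich.
- by apply: approx_sandwich; exact: approx_translate.
- by apply/agree_sym/agree_translatel; rewrite opprK add0r; exact: agree_sym.
have [|z [nz zw1 zag]] := ap1 (`|F t| + r) (e / 2); first by rewrite divr_gt0.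
exists (z + q (m g)); split; first exact: nonsing_shift.
  have -> : z + q (m g) - (A w + (w1 - A w0)) = (z - w1) + A (w0 + q g - w).
    by rewrite q_m homB homD; zmod.
  apply: le_lt_trans (ler_normD _ _) _; rewrite [ltRHS]splitr ltrD//.
  by apply: le_lt_trans (hK _) _; rewrite mulrC -ltr_pdivlMr.
have -> : F a + (a1 - F a0) = (a1 - F t) + p (m g).
  by rewrite aE p_m !homD homN; zmod.
rewrite model_shift.
have ht' : agree r' Q 0 Q0 t by apply: agree_le ht; rewrite le_max lexx.
have h1 := hr' Q Q0 hQ h0 _ _ ht'; rewrite hom0 in h1.
apply: agree_trans h1 _.
have := @agree_shift _ _ _ _ r (F t) _ _ _ _ _ zag; rewrite !add0r => h.
apply: agree_trans (h (lexx _)) _; apply: agree_sym.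
have h2 := @agree_model_translate (a1 - F t) (F t) z r 0.
by rewrite subrK add0r in h2; exact: agree_sym.
Qed.

Lemma iter_homD (U : finNormedModType R) (f : 'End(U)) n x y :
  iter n f (x + y) = iter n f x + iter n f y.
Proof. by elim: n => //= n ->; rewrite homD. Qed.

Lemma iter_hom0 (U : finNormedModType R) (f : 'End(U)) n : iter n f 0 = 0.
Proof. by elim: n => //= n ->; rewrite hom0. Qed.

Lemma iter_homN (U : finNormedModType R) (f : 'End(U)) n x :
  iter n f (- x) = - iter n f x.
Proof. by elim: n => //= n ->; rewrite homN. Qed.

Lemma iter_homB (U : finNormedModType R) (f : 'End(U)) n x y :
  iter n f (x - y) = iter n f x - iter n f y.
Proof. by rewrite iter_homD iter_homN. Qed.

Lemma iter_homZ (U : finNormedModType R) (f : 'End(U)) n a x :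
  iter n f (a *: x) = a *: iter n f x.
Proof. by elim: n => //= n ->; rewrite homZ. Qed.

Lemma iter_cancel (T : Type) (f g : T -> T) n : cancel f g ->
  cancel (iter n f) (iter n g).
Proof.
by move=> fK; elim: n => // n IH x; rewrite iterSr /= fK IH.
Qed.

Lemma iter_bounded (U : finNormedModType R) (f : 'End(U)) n :
  exists2 K : R, 0 < K & forall x, `|iter n f x| <= K * `|x|.
Proof.
have [K K0 hK] := @linear_lipschitz_fin R U U f.
exists (K ^+ n) => [|x]; first by rewrite exprn_gt0.
elim: n => [|n IH] /=; first by rewrite expr0 mul1r.
apply: le_trans (hK _) _.
by rewrite exprS -mulrA ler_pM2l.
Qed.

(* The translation part of the [n]-th iterate of [z |-> f z + b]. *)
Definition drift (E : zmodType) (f : E -> E) (b : E) n := iter n (fun z => f z + b) 0.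

Lemma driftD (U : finNormedModType R) (f : 'End(U)) b n n' :
  drift f b (n + n') = iter n f (drift f b n') + drift f b n.
Proof.
elim: n => [|n IH]; first by rewrite addr0.
by rewrite addSn /= IH homD addrA.
Qed.

Context (K rho : R).
Hypotheses (K0 : 0 <= K) (rho0 : 0 <= rho) (rho1 : rho < 1).
Hypothesis F_contract : forall n x, `|iter n F^-1%VF x| <= K * rho ^+ n * `|x|.

Lemma in_hull_iter sigma n Q : local_map sigma -> in_hull Q ->
  in_hull (iter n sigma Q).
Proof. by move=> [h _] hQ; elim: n => //= n; exact: h. Qed.

(** Pulled back through [n] steps, a ball of radius [c] has radius at most [c * K * rho ^+ n]. The
    geometric series bounds the sum for all iterates at once. *)
Lemma local_map_iter sigma : local_map sigma -> exists2 C : R, 0 <= C &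
  forall n Q Q', in_hull Q -> in_hull Q' -> forall x y, agree C Q x Q' y ->
  forall i, iter n sigma Q i (iter n F x) <-> iter n sigma Q' i (iter n F y).
Proof.
move=> loc; have [_ [c c0 hc]] := loc.
exists (c * K / (1 - rho)).
  by rewrite !mulr_ge0// invr_ge0 subr_ge0 ltW.
move=> n Q Q' hQ hQ'.
suff step : forall x y, agree (c * K * \sum_(j < n) rho ^+ j) Q x Q' y ->
    forall i, iter n sigma Q i (iter n F x) <-> iter n sigma Q' i (iter n F y).
  move=> x y xy; apply: step; apply: agree_le xy.
  rewrite ler_wpM2l ?mulr_ge0// -[leRHS]mul1r ler_pdivlMr ?subr_gt0//.
  have := subrX1 rho n; rewrite -opprB -[rho - 1]opprB mulNr => /oppr_inj.
  by rewrite mulrC => <-; rewrite gerBl exprn_ge0.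
elim: n => [|n IH] x y xy i /=.
  have := xy 0 i; rewrite normr0 !addr0; apply.
  by rewrite big_ord0 mulr0.
apply: hc; [exact: in_hull_iter|exact: in_hull_iter|].
move=> s j sc; have sE : s = iter n F (iter n F^-1%VF s).
  by rewrite (iter_cancel _ FVK).
rewrite sE -!iter_homD; apply: IH; apply: agree_shift xy.
rewrite big_ord_recr /= mulrDr addrC lerD2l.
apply: le_trans (F_contract n s) _; rewrite mulrAC [c * K]mulrC ler_wpM2r ?exprn_ge0//.
by rewrite ler_wpM2l.
Qed.

Lemma lifts_iter sigma b k n Q a w : local_map sigma -> lifts sigma b k ->
  in_hull Q -> approx Q a w ->
  approx (iter n sigma Q) (iter n F a + drift F b n) (iter n A w + drift A k n).
Proof.
move=> loc lf hQ ap; elim: n => [|n IH] /=; first by rewrite !addr0.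
have := lf _ _ _ (in_hull_iter n loc hQ) IH.
by rewrite !homD -!addrA.
Qed.

Context (Hs : seq ('Hom(V, R^o) * R)).
Hypothesis W_boundary : forall i x, boundary (W i) x ->
  exists2 h, h \in Hs & h.1 x = h.2.
Hypothesis Hs_neq0 : forall h, h \in Hs -> h.1 != 0.

Lemma lattice_countable : countable [set: G].
Proof.
apply: (@sub_countable _ _ _ (\bigcup_(n : nat) [set g | `|p g| <= n%:R /\ `|q g| <= n%:R])).
  apply: subset_card_le => g _.
  have [n hn] : exists n, Num.max `|p g| `|q g| <= n%:R.
    exists (Num.truncn (Num.max `|p g| `|q g|)).+1.
    by rewrite ltW// truncnS_gt.
  by exists n => //=; move: hn; rewrite ge_max => /andP.
by apply: bigcup_countable => // n _; exact/finite_set_countable/lattice_finite.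
Qed.

(** The lattice is countable, so each condition excludes countably many values of a form from
    [Hs]. *)
Lemma generic_point (us : seq V) (O : set V) v0 : open O -> O v0 ->
  exists2 v, O v & forall u, u \in us -> [/\ nonsing (u + v),
    forall h, h \in Hs -> h.1 (u + v) != 0 &
    forall g h, h \in Hs -> h.1 (q g + (u + v)) != h.2].
Proof.
move=> oO Ov0.
pose C (f : 'Hom(V, R^o)) := [set t : R | exists2 u, u \in us &
  (t = - f u \/ exists2 h, h \in Hs & exists g, t = h.2 - f (q g + u))].
have cC f : countable (C f).
  apply: countable_exists => u.
  apply: (@sub_countable _ _ _ ([set - f u] `|`
    [set t | exists2 h, h \in Hs & [set h.2 - f (q g + u) | g in [set: G]] t])).
    apply: subset_card_le => t [->|[h hHs [g ->]]]; [by left|right].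
    by exists h => //; exists g.
  apply: countable_setU; first exact/finite_set_countable/finite_set1.
  apply: countable_exists => h.
  by apply: sub_countable (card_image_le _ _) _; exact: lattice_countable.
have [|v Ov hv] := @ex_generic R V [seq h.1 | h <- Hs] C O v0 _ cC oO Ov0.
  by move=> f /mapP[h hHs ->]; exact: Hs_neq0.
exists v => // u uus.
have h3 g h : h \in Hs -> h.1 (q g + (u + v)) != h.2.
  move=> hHs; apply/eqP => e; apply: (hv h.1); first by apply/mapP; exists h.
  exists u => //; right; exists h => //; exists g.
  by rewrite -e addrA [_ + v]addrC lfunD addrK.
split=> // [i g|h hHs]; first by move=> /W_boundary[h /(h3 g) /eqP].
apply/eqP => e; apply: (hv h.1); first by apply/mapP; exists h.
exists u => //; left; apply/eqP; rewrite -subr_eq0 opprK -e lfunD addrC.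
exact: eqxx.
Qed.

Context (i0 : 'I_l).
Hypothesis W_vertex : vertex (W i0) 0.
Hypothesis A_auto : automorphism A.

Let AK : cancel A A^-1%VF. Proof. exact: lker0_lfunK. Qed.

Let AVK : cancel A^-1%VF A. Proof. exact: lker0_lfunVK. Qed.

Let fam (C : R) (a : X) (w : V) (g : G) (h : 'Hom(V, R^o) * R) :=
  [/\ `|p g + a| <= C, exists i, W i (q g + w), h \in Hs & h.1 (q g + w) = h.2].

(* A common direction of the hyperplanes meeting at [w] would be a direction of
   local invariance of [A^-n W] at [w], hence of the tangent cone of [W] at the
   vertex [0]. *)
Lemma vertex_rigid sigma b k : local_map sigma -> lifts sigma b k ->
  exists C, forall n, exists a w, [/\ iter n A w = - drift A k n &
    forall v, (forall g h, fam C a w g h -> h.1 v = 0) -> v = 0].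
Proof.
move=> loc lf; have [C C0 hC] := local_map_iter loc.
(* These make the n-th iterate have parameter zero: its lattice element 0 sits at the origin, and
   its internal image is the vertex. *)
exists C => n; pose a := - iter n F^-1%VF (drift F b n).
pose w := - iter n A^-1%VF (drift A k n).
have aE : iter n F a + drift F b n = 0.
  by rewrite iter_homN (iter_cancel _ FVK) addNr.
have wE : iter n A w = - drift A k n by rewrite iter_homN (iter_cancel _ AVK).
exists a, w; split=> // v hv; apply: contrapT => v0.
have [e e0 he] := agree_cells W_boundary a w C.
(* The iterates are compared at the origin, to which only the lattice element 0 can contribute. *)
have transfer w1 w2 : nonsing w1 -> nonsing w2 ->
    agree C (model a w1) 0 (model a w2) 0 ->
    (W i0)° (iter n A w1 + drift A k n) -> W i0 (iter n A w2 + drift A k n).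
  move=> nw1 nw2 ag Wi.
  have h1 := model_in_hull a nw1; have h2 := model_in_hull a nw2.
  have := lifts_iter n loc lf h1 (approx_model a nw1).
  rewrite aE => /approx_sandwich[_ /(_ i0 0)]; rewrite !raddf0 !add0r => /(_ Wi).
  have := hC n _ _ h1 h2 0 0 ag i0; rewrite iter_hom0 => -> s2.
  have := lifts_iter n loc lf h2 (approx_model a nw2).
  rewrite aE => /approx_sandwich[/(_ i0 0 s2) [g + Wg] _].
  rewrite addr0 -[0 in LHS](raddf0 p) => /p_inj g0.
  by move: Wg; rewrite -g0 raddf0 add0r.
(* [transfer] needs non-singular parameters and an interior starting point. A generic [u'] near [u]
   supplies both, and closedness of the window removes the perturbation. *)
have inv (u : V) t : `|u| < e -> `|u + t *: v| < e ->
    W i0 (iter n A u) -> W i0 (iter n A (u + t *: v)).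
  move=> ue ute Wu; apply: W_closed; apply/closure_normP => d d0.
  have [K1 K10 hK1] := iter_bounded A n.
  have [K2 K20 hK2] := iter_bounded A^-1%VF n.
  pose c := Num.min (Num.min (e - `|u|) (e - `|u + t *: v|)) (d / K1).
  have c0 : 0 < c by rewrite !lt_min !subr_gt0 ue ute divr_gt0.
  pose O := [set u' | `|u' - u| < c] `&` (iter n A) @^-1` (W i0)°.
  have oO : open O.
    apply: openI; first exact: open_dist_ball.
    apply: open_comp => [z _|]; last exact: open_interior.
    by apply: (@lipschitz_continuous _ _ _ _ K1) => x y; rewrite -iter_homB.
  have /closure_normP /(_ (c / K2)) [|z Wz uz] := W_regular Wu.
    exact: divr_gt0.
  have Oz : O (iter n A^-1%VF z).
    split; last by rewrite /= (iter_cancel _ AVK).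
    rewrite /=; have -> : iter n A^-1%VF z - u = iter n A^-1%VF (z - iter n A u).
      by rewrite iter_homB (iter_cancel _ AK).
    apply: le_lt_trans (hK2 _) _; rewrite mulrC -ltr_pdivlMr//.
    by rewrite distrC.
  have [u' [u'c Wu'] gen] := generic_point [:: w; w + t *: v; 0] oO Oz.
  exists (iter n A (u' + t *: v)).
    have [n1 _ _] := gen w (mem_head _ _).
    have [|n2 _ _] := gen (w + t *: v); first by rewrite !inE eqxx orbT.
    have Ak z' : iter n A (w + z') + drift A k n = iter n A z'.
      by rewrite iter_homD wE; zmod.
    rewrite -Ak addrA addrAC; apply: (transfer (w + u')) => //; last by rewrite Ak.
    move: u'c; rewrite /= !lt_min => /andP[/andP[ce1 ce2] _].
    apply: he => [||g i h gC Wg hHs hw].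
    - rewrite addrC addKr -[u'](subrK u); apply: le_lt_trans (ler_normD _ _) _.
      by rewrite -ltrBrDr.
    - have -> : w + t *: v + u' - w = (u' - u) + (u + t *: v) by zmod.
      by apply: le_lt_trans (ler_normD _ _) _; rewrite -ltrBrDr.
    (* Relevant forms vanish on [v], so both parameters lie on the same side of their
       hyperplanes. *)
    have -> : h.1 (w + t *: v + u' - w) = h.1 (w + u' - w).
      have -> : w + t *: v + u' - w = (w + u' - w) + t *: v by zmod.
      by rewrite lfun_add_scale (hv g h) ?mulr0 ?addr0//; split=> //; exists i.
    have [_ _ /(_ g h hHs)] := gen w (mem_head _ _).
    rewrite -hw addrA [_ + u']addrC lfunD -subr_eq0 addrK => hu'.
    rewrite addrC addKr -expr2 lt_def sqr_ge0 andbT expf_neq0//.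
  rewrite -iter_homB; apply: le_lt_trans (hK1 _) _.
  have -> : u + t *: v - (u' + t *: v) = - (u' - u) by zmod.
  rewrite normrN mulrC -ltr_pdivlMr//.
  by move: u'c; rewrite /= !lt_min => /andP[].
case: W_vertex => _; apply; exists (iter n A v).
  by apply/eqP => h; apply: v0; rewrite -[v](iter_cancel n AK) h iter_hom0.
move=> t u [e1 e10 Tu]; pose u' := iter n A^-1%VF u.
have uE : u = iter n A u' by rewrite (iter_cancel _ AVK).
pose d := `|u'| + `|t *: v| + 1.
have d0 : 0 < d by rewrite ltr_wpDl// addr_ge0.
exists (Num.min e1 (e / d / 2)); first by rewrite lt_min e10 !divr_gt0.
move=> s /andP[s0]; rewrite le_min => /andP[se1 se].
have sd : s * d < e.
  apply: (@le_lt_trans _ _ (e / 2)); last by lra.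
  by rewrite -ler_pdivlMr// mulrAC.
have := Tu s; rewrite s0 se1 => /(_ isT); rewrite !add0r.
have -> : s *: u = iter n A (s *: u') by rewrite iter_homZ -uE.
have -> : s *: (u + t *: iter n A v) = iter n A (s *: u' + (s * t) *: v).
  by rewrite uE iter_homD !iter_homZ scalerDr scalerA.
apply: inv.
  rewrite normrZ ger0_norm//; apply: le_lt_trans sd.
  by rewrite ler_wpM2l// /d -addrA lerDl addr_ge0.
apply: le_lt_trans (ler_normD _ _) _; rewrite -scalerA !normrZ ger0_norm//.
apply: le_lt_trans sd; rewrite -mulrDr ler_wpM2l// /d normrZ lerDl.
exact: ler01.
Qed.

Let pB g g' : p (g - g') = p g - p g'. Proof. exact: raddfB. Qed.

Let qB g g' : q (g - g') = q g - q g'. Proof. exact: raddfB. Qed.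

Let qD g g' : q (g + g') = q g + q g'. Proof. exact: raddfD. Qed.

(** Relative to a base element [g0 n], the incidences of hyperplanes at [w n] form a subset of a
    fixed finite set. Two levels with the same record satisfy the same linear equations, which have
    only one solution by rigidity. *)
Lemma drift_lattice sigma b k : local_map sigma -> lifts sigma b k ->
  exists2 n, (0 < n)%N & exists g, drift A k n = q g.
Proof.
move=> loc lf; have [C /choice[a /choice[w hn]]] := vertex_rigid loc lf.
have [v v0] : exists v : V, v != 0.
  have [b0 _] := W_vertex; have [h hHs _] := W_boundary b0.
  apply: contrapT => nv; move: (Hs_neq0 hHs) => /eqP; apply.
  apply/lfunP => v; rewrite lfunE /=; have -> : v = 0; last exact: linear0.
  by apply: contrapT => v0; apply: nv; exists v; apply/eqP.
have /choice[g0 hg0] : forall n, exists g, exists h, fam C (a n) (w n) g h.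
  move=> n; apply: contrapT => nf; have [_ /(_ v)] := hn n.
  move=> vz; move: v0 => /eqP; apply; apply: vz => g h fgh.
  by case: nf; exists g, h.
pose D := [set g | `|p g + 0| <= C + C /\ `|q g + 0| <= B + B] `*` [set` Hs].
have fD : finite_set D.
  by apply: finite_setX; [exact: lattice_near_finite|exact: finite_seq].
have [N pig] := pigeonhole_on fD.
have [i [j [/andP[ij _] fE]]] :=
  pig (fun n x => fam C (a n) (w n) (g0 n + x.1) x.2).
pose z n := q (g0 n) + w n.
have zij : z i - z j = 0.
  have [_] := hn i; apply => g h [gC [c Wg] hHs hw].
  have [h0 [g0C [c0 Wg0] _ _]] := hg0 i.
  have := fE (g - g0 i, h); rewrite /= subrKC => fE'.
  have Dg : D (g - g0 i, h).
    split=> //=; split; rewrite addr0.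
      have -> : p (g - g0 i) = (p g + a i) - (p (g0 i) + a i).
        by rewrite ?pB ?qB; zmod.
      by apply: le_trans (ler_normB _ _) _; exact: lerD.
    have -> : q (g - g0 i) = (q g + w i) - (q (g0 i) + w i).
      by rewrite ?pB ?qB; zmod.
    by apply: le_trans (ler_normB _ _) _; apply: lerD; apply: W_bounded; eassumption.
  have /(fE' Dg).1 [_ _ _ hj] : fam C (a i) (w i) g h by split=> //; exists c.
  rewrite /z lfunB.
  have -> : q (g0 i) + w i = (q g + w i) - q (g - g0 i) by rewrite ?pB ?qB; zmod.
  have -> : q (g0 j) + w j = (q (g0 j + (g - g0 i)) + w j) - q (g - g0 i).
    by rewrite qD qB; zmod.
  by rewrite !(lfunB _ (_ + _)) hw hj subrr.
exists (j - i)%N; first by rewrite subn_gt0.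
exists (iter j m (g0 j - g0 i)).
have q_iter n g : q (iter n m g) = iter n A (q g).
  by elim: n => //= n <-; rewrite q_m.
have [wi _] := hn i; have [wj _] := hn j.
have wij : w i - w j = q (g0 j - g0 i).
  rewrite qB; apply/eqP; rewrite -subr_eq0 -zij; apply/eqP; rewrite /z.
  by zmod.
rewrite q_iter -wij iter_homB wj opprK.
(* The cocycle rule for [drift] identifies the translation part of the iterate [j - i] with
   [A^j (w i - w j)]. *)
have := driftD A k (j - i) i; rewrite subnK ?(ltnW ij)// => ->.
rewrite -[in iter j A (w i)](subnK (ltnW ij)) iterD wi iter_homN.
by zmod.
Qed.

(** By [agree_cells] a patch depends only on the signs of the forms at a generic approximating
    parameter. The number of sign vectors fixes [N] first; then a single radius [r0] would separate
    the patterns up to index [N], were they all distinct. *)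
Lemma fibre_finite (Ps : nat -> colored X l) a w :
  (forall n, approx (Ps n) a w) -> exists i j, (i < j)%N /\ Ps i = Ps j.
Proof.
move=> ap; apply: contrapT => nex.
have [N pig] := pigeonhole_on (finite_seq Hs).
have /choice[r hr] : forall ij : nat * nat, exists r, (ij.1 < ij.2)%N ->
    ~ agree r (Ps ij.1) 0 (Ps ij.2) 0.
  move=> [i j] /=; apply: contrapT => nr; apply: nex; exists i, j.
  have ij : (i < j)%N by apply: contrapT => ij; apply: nr; exists 0 => /ij.
  split=> //; apply: colored_ext => c x; rewrite -[x]add0r.
  have ag : agree `|x| (Ps i) 0 (Ps j) 0.
    by apply: contrapT => nag; apply: nr; exists `|x|.
  exact: ag.
pose r0 : R := \sum_(i < N.+1) \sum_(j < N.+1) `|r (val i, val j)|.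
have [e e0 he] := agree_cells W_boundary a w r0.
have /choice[v hv] : forall n, exists v, [/\ `|v - w| < e,
    agree r0 (Ps n) 0 (model a v) 0 & forall h, h \in Hs -> h.1 (v - w) != 0].
  move=> n; have [w' [nw' ww ag]] := ap n r0 e e0.
  have [e' e'0 he'] := sandwich_locally_constant a r0 nw'.
  have c0 : 0 < Num.min e' (e - `|w' - w|) by rewrite lt_min e'0 subr_gt0.
  have [|v] := generic_point [:: 0; - w] (v0 := w')
    (open_dist_ball w' (Num.min e' (e - `|w' - w|))).
    by rewrite /= subrr normr0.
  rewrite /= lt_min => /andP[ve' ve] gen; exists v.
  have [|_ hw _] := gen (- w); first by rewrite !inE eqxx orbT.
  split=> [||h /hw]; last by rewrite addrC.
    by rewrite -[v](subrK w') -addrA (le_lt_trans (ler_normD _ _))// -ltrBrDr.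
  apply: agree_trans ag _; by apply/agree_sym/(he' v) => //; exact: sandwich_model.
have [i [j [/andP[ij jN] fE]]] := pig (fun n h => 0 < h.1 (v n - w)).
have [vi agi hi] := hv i; have [vj agj hj] := hv j.
apply: (hr (i, j)) => //=.
apply: (@agree_le _ _ _ r0).
  apply: le_trans (ler_norm _) _.
  have iN : (i < N.+1)%N by apply: leq_trans ij _; exact: leqW.
  rewrite /r0 (bigD1 (Ordinal iN))//= (bigD1 (Ordinal (jN : (j < N.+1)%N)))//=.
  by rewrite -addrA lerDl addr_ge0 ?sumr_ge0// => c _; rewrite sumr_ge0.
apply: agree_trans agi _; apply: agree_trans (agree_sym agj).
apply: he => // g c h _ _ hHs _.
have := fE h hHs; move: (hi h hHs) (hj h hHs).
case: (ltgtP (h.1 (v i - w)) 0) => // x0 _; case: (ltgtP (h.1 (v j - w)) 0) => // y0 _ [h1 h2].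
- by rewrite nmulr_rgt0.
- by have := h2 isT.
- by have := h1 isT.
- by rewrite mulr_gt0.
Qed.

Hypothesis m_surj : forall g, exists g', m g' = g.

(** Suitable translates of [P] have images that agree with [P] on ever larger balls, and parameters
    that tend to [(a, w)]. A limit of them is an exact preimage. *)
Lemma fibre_surjective sigma b k P a w : local_map sigma -> lifts sigma b k ->
  (exists g, F a + b = a + p g /\ A w + k = w + q g) ->
  in_hull P -> approx P a w ->
  exists Q, [/\ in_hull Q, approx Q a w & sigma Q = P].
Proof.
move=> loc lf [g [Fa Aw]] hP apP.
have near n : exists Qw, [/\ in_hull Qw.1, `|Qw.2 - w| < n.+1%:R^-1,
    approx Qw.1 a Qw.2 & agree n%:R P 0 (sigma Qw.1) 0].
  have [K1 K10 hK1] := @linear_lipschitz_fin R V V A^-1%VF.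
  have [|r hr] := @agree_close (n.+1%:R^-1 / K1).
    by rewrite divr_gt0// invr_gt0.
  have [[_ [rd hrd]] _] := hP.
  have [x [i _ Px] xrd] := hrd 0; rewrite sub0r normrN in xrd.
  pose r' := Num.max r (Num.max rd n%:R).
  have [t ht] := (LIP _ _).1 (hull_minimal hP (loc.1 _ hP)) r'.
  pose t' := F^-1%VF t; pose Q := translate P (- t').
  have hQ : in_hull Q.
    apply: in_hull_LI hP _; apply/LIP => s; exists t'.
    by apply/agree_translatel; rewrite opprK add0r; exact: agree_refl.
  have apQ : approx Q (a - t') w by exact: approx_translate.
  have sQ : sigma Q = translate (sigma P) (- t).
    by rewrite local_map_translate// homN FVK.
  have ag : agree r' P 0 (sigma Q) 0.
    by rewrite sQ; apply/agree_sym/agree_translatel; rewrite opprK add0r; exact: agree_sym.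
  have apsQ : approx (sigma Q) (F (a - t') + b) (A w + k) by exact: lf.
  have [|||g' ag' wg'] := hr r' _ P (sigma Q) a w _ _ _ _ (approx_sandwich apsQ) ag.
  - by rewrite le_max lexx.
  - by exists i, x; rewrite !le_max xrd orbT.
  - exact: approx_sandwich.
  (* As [m] is onto, the translation is by a lattice projection; absorbing it restores the physical
     parameter [a] exactly. *)
  have [g1 mg1] := m_surj (g + g').
  have t'E : t' = p g1.
    apply: (can_inj FK); rewrite FVK -p_m mg1.
    have e1 : F (a - t') + b = a + p g - t by rewrite homB FVK -(addrA _ (- t)) [- t + b]addrC addrA Fa.
    have -> : p (g + g') = p g + p g' by exact: raddfD.
    apply: (@addrI _ (a - t)); rewrite [RHS](_ : _ = a + p g - t + p g'); last by zmod.
    by rewrite -e1 -ag' subrK.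
  have wE : q g1 = A^-1%VF (A w + k + q g' - w).
    apply: (can_inj AK); rewrite AVK -q_m mg1 qD Aw; zmod.
  exists (Q, w + q g1); split=> //=.
  - rewrite addrC addKr wE; apply: le_lt_trans (hK1 _) _.
    by rewrite mulrC -ltr_pdivlMr.
  - by have := approx_shift g1 apQ; rewrite t'E subrK.
  - by apply: agree_le ag; rewrite !le_max lexx !orbT.
have /choice[Qw hQw] := near.
(* The ultrafilter decides membership of each point. A ball has finitely many candidate points, so
   there the limit agrees with some [Qw n] for arbitrarily large [n]. *)
have [U [UU subU]] := ultraFilterLemma eventually_filter.
have UP : ProperFilter U := @ultra_proper _ _ UU.
pose Q : colored X l := fun i => [set y | U [set n | (Qw n).1 i y]].
have large n0 : U [set n | (n0 <= n)%N] by apply: subU; exact: nbhs_infty_ge.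
have dich i y : U [set n | Q i y <-> (Qw n).1 i y].
  have [h1|h1] := in_ultra_setVsetC [set n | (Qw n).1 i y] UU.
    by apply: (filterS _ h1) => n Qn; split=> // _; exact: h1.
  apply: (filterS _ h1) => n nQn; split=> // Qx; exfalso.
  by have [n' []] := filter_ex (filterI h1 Qx).
have limit r0 n0 : exists n, (n0 <= n)%N /\ agree r0 Q 0 (Qw n).1 0.
  pose D := [set g | `|p g + a| <= r0 /\ `|q g + w| <= B + 1] `*` [set: 'I_l].
  have fD : finite_set D.
    by apply: finite_setX; [exact: lattice_near_finite|exact: finite_finset].
  have UD : U [set n | forall gi, D gi ->
      (Q gi.2 (p gi.1 + a) <-> (Qw n).1 gi.2 (p gi.1 + a))].
    have /finite_setP[c] := fD; elim: c (D) => [|c IH] D' h.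
      by move: h; rewrite II0 card_eq0 => /eqP ->; apply: filterS filterT => n _ gi.
    have [x Dx /IH h'] := eq_cardSP _ _ h.
    apply: filterS (filterI h' (dich x.2 (p x.1 + a))) => n /= [h1 h2] gi Dgi.
    by have [->//|gix] := pselect (gi = x); apply: h1; split.
  have [n [/= nn0 hn]] := filter_ex (filterI (large n0) UD).
  have cand n' s i : `|s| <= r0 -> (Qw n').1 i s -> exists2 g, s = p g + a & D (g, i).
    move=> sr; have [_ ww /approx_sandwich[h _] _] := hQw n'.
    move=> /h[g' sE Wg]; exists g' => //; split=> //; split; first by rewrite /= -sE.
    rewrite /=; have -> : q g' + w = (q g' + (Qw n').2) - ((Qw n').2 - w) by zmod.
    apply: le_trans (ler_normB _ _) _; apply: lerD; first exact: W_bounded Wg.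
    apply: ltW; apply: lt_le_trans ww _.
    by rewrite invf_le1 ?ler1n// ltr0n.
  exists n; split=> // s i sr; rewrite add0r; split=> [Qs|Qs].
    have [n' Qn'] := filter_ex Qs.
    by have [g' sE /hn] := cand n' s i sr Qn'; rewrite /= -sE => -[+ _]; exact.
  by have [g' sE /hn] := cand n s i sr Qs; rewrite /= -sE => -[_]; exact.
have hQ : in_hull Q.
  apply: (in_hull_LI hP); apply/LIP => r0; have [n [_ ag]] := limit r0 0%N.
  have [hn _ _ _] := hQw n; have [t ht] := (LIP _ _).1 (hull_minimal hn hP) r0.
  by exists t; apply: agree_trans ag ht.
exists Q; split=> //.
  move=> r0 e e0; have e2 : 0 < e / 2 by rewrite divr_gt0.
  have [n [nn ag]] := limit r0 (Num.truncn (e / 2)^-1).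
  have [_ ww apn _] := hQw n; have [w' [nw' ww' ag']] := apn r0 _ e2.
  exists w'; split=> //; last exact: agree_trans ag ag'.
  have -> : w' - w = (w' - (Qw n).2) + ((Qw n).2 - w) by zmod.
  apply: le_lt_trans (ler_normD _ _) _; rewrite [ltRHS]splitr ltrD//.
  apply: lt_le_trans ww _; rewrite invf_ple ?posrE ?ltr0n//.
  by apply: ltW; apply: lt_le_trans (truncnS_gt _) _; rewrite ler_nat.
apply: colored_ext => i x.
have [r' hr'] := local_map_agree loc `|x|.
have [n [nn ag]] := limit r' (Num.truncn `|x|).+1.
have [hn _ _ agn] := hQw n; have := hr' _ _ hQ hn _ _ ag.
rewrite hom0 => agx; rewrite -[x]add0r (agx x i (lexx _)).
apply: iff_sym; apply: agn; apply: ltW; apply: lt_le_trans (truncnS_gt _) _.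
by rewrite ler_nat.
Qed.

(** Follow preimages inside the finite fibre until one repeats; applying [sigma] moves the
    repetition back to [P]. *)
Lemma fibre_periodic sigma b k P a w : local_map sigma -> lifts sigma b k ->
  (exists g, F a + b = a + p g /\ A w + k = w + q g) ->
  in_hull P -> approx P a w -> exists2 n, (0 < n)%N & iter n sigma P = P.
Proof.
move=> loc lf fix_ hP apP.
pose fibre Q := in_hull Q /\ approx Q a w.
have /choice[pre hpre] : forall Q, exists Q', fibre Q -> fibre Q' /\ sigma Q' = Q.
  move=> Q; have [[hQ apQ]|nQ] := pselect (fibre Q); last by exists Q.
  by have [Q' [h1 h2 h3]] := fibre_surjective loc lf fix_ hQ apQ; exists Q'.
have fib n : fibre (iter n pre P) by elim: n => //= n /hpre[].
have siter n n' : iter n sigma (iter (n + n') pre P) = iter n' pre P.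
  elim: n => // n IH; rewrite iterSr addSn /=.
  by have [_ ->] := hpre _ (fib (n + n')%N).
have [|i [j [ij PE]]] := @fibre_finite (fun n => iter n pre P) a w.
  by move=> n; have [] := fib n.
exists (j - i)%N; first by rewrite subn_gt0.
have := siter i 0%N; rewrite addn0 PE -{1}(subnKC (ltnW ij)) siter => PE'.
by have := siter (j - i)%N 0%N; rewrite addn0 PE'.
Qed.

Lemma iter_bounded_upto (U : finNormedModType R) (f : 'End(U)) N :
  exists2 c : R, 0 < c & forall j x, (j <= N)%N -> `|iter j f x| <= c * `|x|.
Proof.
have /choice[c hc] : forall j, exists c, 0 < c /\ forall x, `|iter j f x| <= c * `|x|.
  by move=> j; have [c c0 h] := iter_bounded f j; exists c.
exists (\sum_(j < N.+1) c j).
  rewrite big_ord_recl; apply: ltr_wpDr; last by have [] := hc 0%N.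
  by apply: sumr_ge0 => j _; have [/ltW] := hc (lift ord0 j).
move=> j x jN; have [_ /(_ x) h] := hc j; apply: le_trans h _.
rewrite ler_wpM2r// (bigD1 (Ordinal (jN : (j < N.+1)%N)))//= lerDl sumr_ge0//.
by move=> i _; have [/ltW] := hc i.
Qed.

(* Solomyak's argument: among sufficiently many levels, two show the same pair
   of local configurations around [x] and [y]; agreement of [P] at the first
   level then propagates to agreement of the preimages. *)
Lemma fixed_recognizable sigma P a w : local_map sigma -> in_hull P ->
  approx P a w -> sigma P = P -> LD (lin_image F P) P.
Proof.
move=> loc hP apP sP.
have [C C0 hC] := local_map_iter loc.
have sPn n : iter n sigma P = P by elim: n => //= n ->.
have rule n x y : agree C P x P y -> forall i, P i (iter n F x) <-> P i (iter n F y).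
  by move=> xy i; have := hC n P P hP hP x y xy i; rewrite sPn.
have Fn n x : `|iter n F^-1%VF x| <= K * `|x|.
  apply: le_trans (F_contract n x) _; rewrite ler_wpM2r// ler_piMr//.
  by rewrite exprn_ile1// ltW.
have [sw1 sw2] := approx_sandwich apP.
have [[_ [rd hrd]] _] := hP.
have rd0 : 0 <= rd by have [y _] := hrd 0; apply: le_trans.
(* Recording radius: the uniform radius [C], the size of a [C]-ball pulled back by any number of
   steps, and the distance to a nearby point of [P]. *)
pose C2 := C + K * C + rd.
pose D := [set g | `|p g + 0| <= C2 /\ `|q g + 0| <= B + B + 1] `*`
  ([set: 'I_l] `*` [set: bool]).
have [|N pig] := @pigeonhole_on _ D.
  apply: finite_setX; first exact: lattice_near_finite.
  by apply: finite_setX; exact: finite_finset.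
have [KA KA0 hKA] := iter_bounded_upto A^-1%VF N.
have [KF KF0 hKF] := iter_bounded_upto F N.
(* Makes [q g] so small that its backward images up to level [N] have norm at most 1, the extra 1 in
   [D]. *)
have [|r2 hr2] := @agree_close KA^-1; first by rewrite invr_gt0.
pose r := Num.max r2 (Num.max rd (KF * (rd + rd + K * C))).
apply/LDP; exists `|r| => // x y xy0 i.
have xy : agree r P x P y := agree_le (ler_norm r) xy0.
rewrite -[x]FVK -[y]FVK !lin_imageE; try exact: can_inj FK.
have [|||||g yx qg] := hr2 r _ (translate P (- x)) (translate P (- y)) (a - x) w (a - y) w.
- by rewrite le_max lexx.
- have [z [c _ Pz] xz] := hrd x; exists c, (z - x); rewrite translateE opprK subrK.
  by split=> //; rewrite distrC !le_max xz orbT.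
- by apply: approx_sandwich; exact: approx_translate.
- by apply: approx_sandwich; exact: approx_translate.
- apply/agree_translatel/agree_sym/agree_translatel; rewrite !opprK !add0r.
  exact: agree_sym.
have yE : y = x + p g by apply: (@addIr _ (a - x)); rewrite {1}yx; zmod.
have /choice[m' m'K] := m_surj.
have pm' g' : p (m' g') = F^-1%VF (p g') by apply: (can_inj FK); rewrite FVK -p_m m'K.
have qm' g' : q (m' g') = A^-1%VF (q g') by apply: (can_inj AK); rewrite AVK -q_m m'K.
pose gj j := iter j m' g.
have pgj j : p (gj j) = iter j F^-1%VF (p g) by elim: j => //= j <-; rewrite pm'.
have qgj j : (j <= N)%N -> `|q (gj j)| <= 1.
  move=> jN; have -> : q (gj j) = iter j A^-1%VF (q g).
    by elim: j {jN} => //= j <-; rewrite qm'.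
  apply: le_trans (hKA _ _ jN) _; rewrite mulrC -ler_pdivlMr// mul1r ltW//.
  by move: qg; rewrite addrC addKr.
pose xj j := iter j F^-1%VF x; pose yj j := iter j F^-1%VF y.
have yjE j : yj j = xj j + p (gj j) by rewrite /yj yE iter_homD pgj.
(* A point of [P] near [xj j] serves as base, so that the surroundings of [xj j] and [yj j] are
   recorded by lattice elements from the fixed set [D]. *)
have /choice[h hj] : forall j, exists h,
    `|xj j - (p h + a)| <= rd /\ exists c, W c (q h + w).
  move=> j; have [z [c _ Pz] xz] := hrd (xj j); have [h zE Wh] := sw1 _ _ Pz.
  by exists h; rewrite -zE; split=> //; exists c.
pose o j := p (h j) + a - xj j.
have ord_ j : `|o j| <= rd by rewrite distrC; have [] := hj j.
pose sh (b : bool) j := if b then gj j else 0.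
have [j [k [/andP[jk kN] fE]]] := pig (fun j d =>
  P d.2.1 (p (h j) + a + p (sh d.2.2 j) + p d.1)).
have half b j1 j2 : (j1 <= N)%N -> (forall d, D d ->
    P d.2.1 (p (h j1) + a + p (sh d.2.2 j1) + p d.1) ->
    P d.2.1 (p (h j2) + a + p (sh d.2.2 j2) + p d.1)) ->
    forall s i, `|s| <= C2 -> P i (p (h j1) + a + p (sh b j1) + s) ->
    P i (p (h j2) + a + p (sh b j2) + s).
  move=> j1N imp s c sC Ps; have [h' sE Wh'] := sw1 _ _ Ps.
  pose d := h' - h j1 - sh b j1.
  have sd : s = p d.
    by apply: (addrI (p (h j1) + a + p (sh b j1))); rewrite sE /d !pB; zmod.
  rewrite sd; apply: (imp (d, (c, b))); last by rewrite /= -sd.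
  split=> //; split; first by rewrite /= addr0 -sd.
  have [c' Wh] := (hj j1).2.
  rewrite /= addr0 !qB.
  have -> : q h' - q (h j1) - q (sh b j1) = (q h' + w) - (q (h j1) + w) - q (sh b j1) by zmod.
  apply: le_trans (ler_normB _ _) _; apply: lerD.
    by apply: le_trans (ler_normB _ _) _; apply: lerD; apply: W_bounded; eassumption.
  by case: (b) => /=; [exact: qgj|rewrite raddf0 normr0].
have conf b : agree C2 P (p (h j) + a + p (sh b j)) P (p (h k) + a + p (sh b k)).
  have jN : (j <= N)%N by rewrite ltnW// (leq_trans jk).
  move=> s c sC; split; apply: half => // d /fE [h1 h2]; [exact: h1|exact: h2].
have [k' kE] : exists k', k = k'.+1 by case: (k) jk => // k' _; exists k'.
have jk' : (j <= k')%N by rewrite -ltnS -kE.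
(* One step back is [k] steps back, then [j] and finally [k' - j] steps forward. This isolates the
   place where level [k] can be exchanged for level [j]. *)
have back z : F^-1%VF z = iter (k' - j) F (iter j F (iter k F^-1%VF z)).
  by rewrite -iterD subnK// kE iterSr (iter_cancel _ FVK).
rewrite (back x) (back y); apply: (rule (k' - j)%N) => s c sC.
pose s' := iter j F^-1%VF s.
have sE : s = iter j F s' by rewrite (iter_cancel _ FVK).
have s'C : `|s'| <= K * C.
  by apply: le_trans (Fn _ _) _; rewrite ler_wpM2l.
have okC : `|s' - o k| + C <= C2.
  rewrite /C2 addrC -addrA lerD2l; apply: le_trans (ler_normB _ _) _.
  exact: lerD.
have agZ b := agree_shift okC (conf b).
rewrite sE -!iter_homD.
have -> : iter k F^-1%VF x + s' = p (h k) + a + p (sh false k) + (s' - o k).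
  by rewrite /o /sh raddf0 /xj; zmod.
have -> : iter k F^-1%VF y + s' = p (h k) + a + p (sh true k) + (s' - o k).
  by rewrite -/(yj k) yjE /o /sh; zmod.
(* After the exchange, [j] steps forward from level [j] return to [x] and [y] themselves, up to a
   bounded shift. *)
rewrite -(rule j _ _ (agZ false)) -(rule j _ _ (agZ true)).
pose t := o j + s' - o k.
have -> : p (h j) + a + p (sh false j) + (s' - o k) = xj j + t.
  by rewrite /t /o /sh raddf0; zmod.
have -> : p (h j) + a + p (sh true j) + (s' - o k) = yj j + t.
  by rewrite yjE /t /o /sh; zmod.
have jt z : iter j F (iter j F^-1%VF z + t) = z + iter j F t.
  by rewrite iter_homD (iter_cancel _ FVK).
rewrite /xj /yj !jt; apply: xy.
apply: le_trans (hKF _ _ _) _; first by rewrite ltnW// (leq_trans jk).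
rewrite !le_max; apply/orP; right; apply/orP; right; rewrite ler_pM2l//.
have -> : t = (o j - o k) + s' by rewrite /t; zmod.
apply: le_trans (ler_normD _ _) _; apply: lerD => //.
by apply: le_trans (ler_normB _ _) _; apply: lerD.
Qed.

End LocalMaps.

(** * Powers of the expansion and the two directions of the equivalence *)

Section Powers.
Context (U : finNormedModType R).
Implicit Type f : 'End(U).

Lemma lfun_expE f n x : lfun_exp f n x = iter n f x.
Proof.
rewrite /lfun_exp; elim: n => [|n IH] /=; first by rewrite id_lfunE.
by rewrite comp_lfunE IH.
Qed.

Lemma automorphism_exp f n : automorphism f -> automorphism (lfun_exp f n).
Proof.
move=> /lker0_lfunK fK; apply/lker0P => x y; rewrite !lfun_expE.
exact: (can_inj (iter_cancel n fK)).
Qed.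

Lemma lfun_exp_inv f n x : automorphism f ->
  (lfun_exp f n)^-1%VF x = iter n f^-1%VF x.
Proof.
move=> fa; have /lker0_lfunVK fVK := fa.
have /lker0_lfunK eK := automorphism_exp n fa.
by rewrite -[x in LHS](iter_cancel n fVK) -lfun_expE eK.
Qed.

Lemma iter_exp f n k x : iter k (lfun_exp f n) x = iter (k * n) f x.
Proof.
by elim: k => //= k ->; rewrite lfun_expE -iterD.
Qed.

Lemma contracting_exp f (K rho : R) n : automorphism f ->
  0 <= K -> 0 <= rho -> rho < 1 ->
  (forall k x, `|iter k f^-1%VF x| <= K * rho ^+ k * `|x|) -> (0 < n)%N ->
  forall k x, `|iter k (lfun_exp f n)^-1%VF x| <= K * rho ^+ k * `|x|.
Proof.
move=> fa K0 rho0 rho1 hf n0 k x.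
have -> : iter k (lfun_exp f n)^-1%VF x = iter (k * n) f^-1%VF x.
  by elim: k => //= k ->; rewrite lfun_exp_inv// -iterD.
apply: le_trans (hf _ _) _; rewrite ler_wpM2r// ler_wpM2l//.
by rewrite ler_wiXn2l ?(ltW rho1)// leq_pmulr.
Qed.

End Powers.

Context (L : 'End(X)) (A : 'End(V)) (m : G -> G) (K rho : R).
Hypotheses (L_auto : automorphism L) (A_auto : automorphism A).
Hypothesis p_m : forall g, p (m g) = L (p g).
Hypothesis q_m : forall g, q (m g) = A (q g).
Hypothesis m_surj : forall g, exists g', m g' = g.
Hypotheses (K0 : 0 <= K) (rho0 : 0 <= rho) (rho1 : rho < 1).
Hypothesis L_contract : forall n x, `|iter n L^-1%VF x| <= K * rho ^+ n * `|x|.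
Context (Hs : seq ('Hom(V, R^o) * R)) (i0 : 'I_l).
Hypothesis W_boundary : forall i x, boundary (W i) x ->
  exists2 h, h \in Hs & h.1 x = h.2.
Hypothesis Hs_neq0 : forall h, h \in Hs -> h.1 != 0.
Hypothesis W_vertex : vertex (W i0) 0.

Let p_mn n g : p (iter n m g) = lfun_exp L n (p g).
Proof. by rewrite lfun_expE; elim: n => //= n <-; rewrite p_m. Qed.

Let q_mn n g : q (iter n m g) = lfun_exp A n (q g).
Proof. by rewrite lfun_expE; elim: n => //= n <-; rewrite q_m. Qed.

Let mn_surj n g : exists g', iter n m g' = g.
Proof.
elim: n g => [|n IH] g; first by exists g.
by have [g1 <-] := m_surj g; have [g2 <-] := IH g1; exists g2.
Qed.

Section SelfAffine.
Context (P : colored X l) (a : X) (w : V) (n : nat).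
Hypotheses (P_hull : in_hull P) (P_approx : approx P a w) (n_gt0 : (0 < n)%N).
Hypothesis P_self_affine : LD P (lin_image (lfun_exp L n) P).

Lemma self_affine_substitution : exists2 sigma,
  substitution_map in_hull (lfun_exp L n) sigma & sigma P = P.
Proof. exact: (LD_substitution (automorphism_exp n L_auto)). Qed.

Lemma self_affine_LIDS : LD (lin_image (lfun_exp L n) P) P.
Proof.
have [sigma sub sP] := self_affine_substitution.
have nL := automorphism_exp n L_auto.
have loc := substitution_local_map nL sub.
exact: (fixed_recognizable nL (p_mn n) (q_mn n) K0 rho0 rho1
  (contracting_exp L_auto K0 rho0 rho1 L_contract n_gt0)
  (automorphism_exp n A_auto) (mn_surj n) loc P_hull P_approx sP).
Qed.

(** As [sigma] fixes [P], its affine map can be taken to fix [w], so iterates of its linear part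
    move [w] by minus their [drift]. *)
Lemma self_affine_rational : exists2 k, (0 < k)%N & exists g, iter k A w = w + q g.
Proof.
have [sigma sub sP] := self_affine_substitution.
have nL := automorphism_exp n L_auto.
have loc := substitution_local_map nL sub.
have P_approx' : approx (sigma P) a w by rewrite sP.
have lf := local_map_lifts nL (p_mn n) (q_mn n) loc P_hull P_approx P_approx'.
have [k k0 [g dg]] := drift_lattice nL (q_mn n) K0 rho0 rho1
  (contracting_exp L_auto K0 rho0 rho1 L_contract n_gt0) W_boundary Hs_neq0
  W_vertex (automorphism_exp n A_auto) loc lf.
exists (k * n)%N; first by rewrite muln_gt0 k0.
exists (- g); rewrite raddfN /= -dg -iter_exp.
elim: k {k0 dg} => [|k IH] /=; first by rewrite subr0.
by rewrite IH homB; zmod.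
Qed.

End SelfAffine.

Lemma in_hull_translate P t : in_hull P -> in_hull (translate P t).
Proof.
move=> hP; apply: (in_hull_LI hP); apply/LIP => r; exists (- t).
by apply/agree_translatel; rewrite sub0r; exact: agree_refl.
Qed.

(** Periods divisible by a prescribed [k] are asked for because [w] must return at an iterate whose
    [drift] is a lattice projection. *)
Lemma rational_self_affine P a w P' a' w' m0 : (0 < m0)%N ->
  in_hull P -> approx P a w -> in_hull P' -> approx P' a' w' ->
  LD P (lin_image (lfun_exp L m0) P') ->
  (forall k, (0 < k)%N -> exists2 i, (0 < i)%N & exists g, iter (k * i) A w = w + q g) ->
  exists2 n, (0 < n)%N & LD P (lin_image (lfun_exp L n) P).
Proof.
move=> m00 hP apP hP' apP' ld rat.
pose F := lfun_exp L m0; pose A' := lfun_exp A m0.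
have Fa : automorphism F := automorphism_exp m0 L_auto.
have A'a : automorphism A' := automorphism_exp m0 A_auto.
have [sigma sub sP] := LD_substitution Fa hP hP' ld.
have loc := substitution_local_map Fa sub.
have apP2 : approx (sigma P') a w by rewrite sP.
have lf := local_map_lifts Fa (p_mn m0) (q_mn m0) loc hP' apP' apP2.
have Fc := contracting_exp L_auto K0 rho0 rho1 L_contract m00.
have [n0 n00 [g0 dg0]] := drift_lattice Fa (q_mn m0) K0 rho0 rho1 Fc W_boundary
  Hs_neq0 W_vertex A'a loc lf.
have [i i0' [g1 wg1]] : exists2 i, (0 < i)%N & exists g, iter (n0 * i) A' w = w + q g.
  have [|i i0' [g hg]] := rat (n0 * m0)%N; first by rewrite muln_gt0 n00.
  by exists i => //; exists g; rewrite iter_exp mulnAC.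
set b := a - _ in lf; set k := w - _ in lf dg0.
have [g2 dg2] : exists g, drift A' k (n0 * i) = q g.
  elim: (i) => [|j [g hg]]; first by exists 0; rewrite muln0 raddf0.
  exists (iter (n0 * m0) m g + g0); rewrite mulnS driftD hg -[A']/(A') dg0.
  by rewrite iter_exp -lfun_expE -q_mn raddfD.
pose q0 := (n0 * i)%N; pose F2 := lfun_exp F q0.
have F2a : automorphism F2 := automorphism_exp q0 Fa.
(* The physical error: translating by [- t] makes the iterate fix [(a, w)] up to the single lattice
   element [g1 + g2]. *)
pose t := iter q0 F a + drift F b q0 - (a + p (g1 + g2)).
pose f Q := translate (iter q0 sigma Q) (- t).
have [C C0 hC] := local_map_iter Fa K0 rho0 rho1 Fc loc.
have floc : local_map F2 f.
  split=> [Q hQ|]; first exact: (in_hull_translate (- t) (in_hull_iter q0 loc hQ)).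
  exists (`|F2^-1%VF t| + C); first by rewrite addr_ge0.
  move=> Q Q' hQ hQ' x y xy j; rewrite /f !translateE opprK.
  have F2t z : F2 z + t = iter q0 F (z + F2^-1%VF t).
    by rewrite -lfun_expE homD lker0_lfunVK.
  rewrite !F2t; apply: hC => //; exact: agree_shift xy.
have flf : lifts F2 (lfun_exp A' q0) f (drift F b q0 - t) (drift A' k q0).
  move=> Q c v hQ apQ; rewrite !lfun_expE addrA; apply: approx_translate.
  exact: lifts_iter.
have pm2 g : p (iter q0 (iter m0 m) g) = F2 (p g).
  by rewrite lfun_expE; elim: (q0) => //= j <-; rewrite p_mn.
have qm2 g : q (iter q0 (iter m0 m) g) = lfun_exp A' q0 (q g).
  by rewrite lfun_expE; elim: (q0) => //= j <-; rewrite q_mn.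
have m2_surj g : exists g', iter q0 (iter m0 m) g' = g.
  elim: (q0) g => [|j IH] g; first by exists g.
  by have [g3 <-] := mn_surj m0 g; have [g4 <-] := IH g3; exists g4.
have [|n n00' fP] := fibre_periodic F2a pm2 qm2 W_boundary Hs_neq0
  (automorphism_exp q0 A'a) m2_surj floc flf _ hP apP.
  exists (g1 + g2); split; first by rewrite lfun_expE /t; zmod.
  by rewrite lfun_expE wg1 dg2 (raddfD q) addrA.
have F2c := contracting_exp Fa K0 rho0 rho1 Fc (_ : (0 < q0)%N).
have [|C2 C20 hC2] := local_map_iter F2a K0 rho0 rho1 (F2c _) floc.
  by rewrite muln_gt0 n00.
exists (n * (q0 * m0))%N; first by rewrite !muln_gt0 n00' n00 i0'.
have La := automorphism_exp (n * (q0 * m0)) L_auto.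
have iF2 x : iter n F2 x = lfun_exp L (n * (q0 * m0)) x.
  rewrite lfun_expE iterM; elim: (n) => //= j ->.
  by rewrite lfun_expE iter_exp.
have [c hc] : exists c, forall Q Q' : colored X l, forall x y,
    agree c (lin_image (lfun_exp L (n * (q0 * m0))) Q) (lfun_exp L (n * (q0 * m0)) x)
      (lin_image (lfun_exp L (n * (q0 * m0))) Q') (lfun_exp L (n * (q0 * m0)) y) ->
    agree C2 Q x Q' y.
  have [K1 K10 hK1] := @linear_lipschitz_fin R X X (lfun_exp L (n * (q0 * m0))).
  exists (K1 * C2) => Q Q' x y h s j sC.
  rewrite -(lin_imageE Q j (x + s) (lker0P La)) -(lin_imageE Q' j (y + s) (lker0P La)).
  rewrite !homD; apply: h; apply: le_trans (hK1 _) _.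
  by rewrite ler_pM2l.
apply/LDP; exists `|c| => // x y xy j.
rewrite -[x](lker0_lfunVK La) -[y](lker0_lfunVK La) in xy *.
have := hC2 n P P hP hP _ _ (hc _ _ _ _ (agree_le (ler_norm c) xy)) j.
by rewrite fP !iF2.
Qed.

End ModelSets.

(** * Projections along complementary subspaces and restrictions *)

Section Projections.
Context (R : realType) (E : finNormedModType R).

Lemma proj_along_linear (U W : {vspace E}) : linear (proj_along U W).
Proof. by move=> a x y; rewrite /proj_along !linearP. Qed.

HB.instance Definition _ (U W : {vspace E}) :=
  GRing.isLinear.Build R E (subvs_of U) _ (proj_along U W) (proj_along_linear U W).

Context (U W : {vspace E}).
Hypotheses (UW_add : (U + W)%VS = {:E}%VS) (UW_cap : (U :&: W)%VS = 0%VS).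

Lemma proj_alongD x y : proj_along U W (x + y) = proj_along U W x + proj_along U W y.
Proof. exact: linearD. Qed.

Lemma proj_along_sum x : vsval (proj_along U W x) + vsval (proj_along W U x) = x.
Proof.
rewrite /proj_along !vsprojK ?memv_pi// daddv_pi_add// UW_add memvf //.
Qed.

Lemma proj_along_id (u : subvs_of U) : proj_along U W (vsval u) = u.
Proof.
by rewrite /proj_along daddv_pi_id// ?vsvalK// subvsP.
Qed.

Lemma proj_along_eq0 (w : subvs_of W) : proj_along U W (vsval w) = 0.
Proof.
apply: val_inj => /=; apply: (@addIr _ (vsval (proj_along W U (vsval w)))).
rewrite proj_along_sum add0r.
by rewrite /proj_along daddv_pi_id ?vsvalK ?subvsP// capvC.
Qed.

Definition restr (M : 'End(E)) : 'End(subvs_of U) :=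
  linfun (vsproj U \o M \o vsval).

Context (M : 'End(E)).
Hypotheses (MU : (M @: U)%VS = U) (MW : (M @: W)%VS = W).

Lemma vsval_restr (u : subvs_of U) : vsval (restr M u) = M (vsval u).
Proof.
have := memv_img M (subvsP u); rewrite MU => Mu.
by rewrite /restr lfunE /= vsprojK.
Qed.

Lemma restr_automorphism : automorphism M -> automorphism (restr M).
Proof.
move=> /lker0P Minj; apply/lker0P => x y /(congr1 vsval).
by rewrite !vsval_restr => /Minj /val_inj.
Qed.

End Projections.

Section RestrictionProj.
Context (R : realType) (E : finNormedModType R) (U W : {vspace E}) (M : 'End(E)).
Hypotheses (UW_add : (U + W)%VS = {:E}%VS) (UW_cap : (U :&: W)%VS = 0%VS).
Hypotheses (MU : (M @: U)%VS = U) (MW : (M @: W)%VS = W).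

Lemma restr_proj x : proj_along U W (M x) = restr U M (proj_along U W x).
Proof.
rewrite -[x in LHS](proj_along_sum UW_add UW_cap) homD proj_alongD.
rewrite -(vsval_restr MU) -(vsval_restr MW) proj_along_id// proj_along_eq0//.
by rewrite addr0.
Qed.

End RestrictionProj.

(** * The lattice in integer coordinates *)

Section Lattice.
Context (R : realType) (E : finNormedModType R) (S : cps E).
Context (b : (\dim {:E}).-tuple E) (b_basis : basis_of {:E} b).
Hypothesis lattice_b : lattice S = inIntSpan b.

Let X := subvs_of (phys S).
Let V := subvs_of (intl S).
Let k := \dim {:E}.
Let G := {ffun 'I_k -> int}.

Definition lattice_point (z : {ffun 'I_(\dim {:E}) -> int}) : E :=
  \sum_(i < \dim {:E}) b`_i *~ z i.

Lemma lattice_point_additive : zmod_morphism lattice_point.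
Proof.
move=> x y; rewrite -sumrB; apply: eq_bigr => i _.
by rewrite !ffunE mulrzBr.
Qed.

HB.instance Definition _ := GRing.isZmodMorphism.Build
  {ffun 'I_(\dim {:E}) -> int} E lattice_point lattice_point_additive.

Lemma latticeP x : lattice S x <-> exists z, x = lattice_point z.
Proof. by rewrite lattice_b. Qed.

Lemma lattice_point_lattice z : lattice S (lattice_point z).
Proof. by apply/latticeP; exists z. Qed.

Let fb : free b. Proof. exact: basis_free b_basis. Qed.

Lemma coord_lattice_point z i : coord b i (lattice_point z) = (z i)%:~R.
Proof.
rewrite /lattice_point -(coord_sum_free (fun i => (z i)%:~R) i fb).
by congr coord; apply: eq_bigr => j _; rewrite scaler_int.
Qed.

Lemma lattice_point_inj : injective lattice_point.
Proof.
move=> x y e; apply/ffunP => i; apply: (@intr_inj R).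
by rewrite -!coord_lattice_point e.
Qed.

Definition lattice_phys := (to_phys S \o lattice_point).
Definition lattice_intl := (to_intl S \o lattice_point).

Lemma lattice_phys_additive : zmod_morphism lattice_phys.
Proof. by move=> x y; rewrite /lattice_phys /= /to_phys !raddfB. Qed.

Lemma lattice_intl_additive : zmod_morphism lattice_intl.
Proof. by move=> x y; rewrite /lattice_intl /= /to_intl !raddfB. Qed.

HB.instance Definition _ := GRing.isZmodMorphism.Build
  {ffun 'I_(\dim {:E}) -> int} (subvs_of (phys S)) lattice_phys lattice_phys_additive.

HB.instance Definition _ := GRing.isZmodMorphism.Build
  {ffun 'I_(\dim {:E}) -> int} (subvs_of (intl S)) lattice_intl lattice_intl_additive.

Lemma to_physD x y : to_phys S (x + y) = to_phys S x + to_phys S y.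
Proof. exact: linearD. Qed.

Lemma to_physB x y : to_phys S (x - y) = to_phys S x - to_phys S y.
Proof. exact: linearB. Qed.

Lemma to_intlD x y : to_intl S (x + y) = to_intl S x + to_intl S y.
Proof. exact: linearD. Qed.

Lemma to_intlB x y : to_intl S (x - y) = to_intl S x - to_intl S y.
Proof. exact: linearB. Qed.

Lemma phys_intl_sum x : vsval (to_phys S x) + vsval (to_intl S x) = x.
Proof. exact: (proj_along_sum (phys_add_intl S) (phys_cap_intl S)). Qed.

Lemma lattice_phys_inj : injective lattice_phys.
Proof.
move=> x y e; apply: lattice_point_inj.
apply: (@proj_phys_inj _ _ S) => //; apply/mem_set; exact: lattice_point_lattice.
Qed.

(** Bounds on both projections bound the norm, hence the integer coordinates. *)
Lemma lattice_phys_intl_finite (r : R) :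
  finite_set [set z | `|lattice_phys z| <= r /\ `|lattice_intl z| <= r].
Proof.
have [c c0 hc] : exists2 c : R, 0 < c & forall i x, `|coord b i x| <= c * `|x|.
  have /choice[c hc] : forall i : 'I_k, exists c : R,
      0 < c /\ forall x, `|coord b i x| <= c * `|x|.
    move=> i; have [c c0 hc] := @linear_lipschitz_fin R E R^o (coord b i).
    by exists c.
  exists (1 + \sum_i c i).
    by rewrite ltr_pwDl// sumr_ge0// => i _; have [/ltW] := hc i.
  move=> i x; have [_ h] := hc i; apply: le_trans (h x) _.
  rewrite ler_wpM2r// (bigD1 i)//= addrCA lerDl addr_ge0// sumr_ge0// => j _.
  by have [/ltW] := hc j.
pose N := Num.truncn (c * (r + r)).
pose f (u : {ffun 'I_k -> 'I_(N.+1 + N.+1)}) : G :=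
  [ffun i => (u i : nat)%:Z - N.+1%:Z].
apply: (@sub_finite_set _ _ (f @` setT)).
  move=> z [zp zi].
  have zb i : `|z i| < N.+1%:Z.
    have : `|(z i)%:~R : R| < N.+1%:R.
      rewrite -coord_lattice_point; apply: le_lt_trans (hc _ _) _.
      apply: (@le_lt_trans _ _ (c * (r + r))); last exact: truncnS_gt.
      rewrite ler_pM2l// -[lattice_point z]phys_intl_sum.
      by apply: le_trans (ler_normD _ _) _; apply: lerD.
    by rewrite -intr_norm -[N.+1%:R]/(N.+1%:~R) ltr_int.
  have zu i : (`|(z i + N.+1%:Z)%R|%N < N.+1 + N.+1)%N by have := zb i; lia.
  exists [ffun i => Ordinal (zu i)] => //; apply/ffunP => i; rewrite !ffunE /=.
  by have := zb i; lia.
apply: finite_image; exact: finite_finset.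
Qed.

(** Density alone does not control the physical part. The target [y] is reduced modulo the lattice
    to a point [rho u] of a finite grid, up to a small [d]. Density is used once per grid point, so
    finitely many physical parts occur. *)
Lemma lattice_relatively_dense (O : set (subvs_of (intl S))) :
  open O -> O !=set0 -> exists r : R, forall x w,
    exists2 z, `|lattice_phys z - x| <= r & O (lattice_intl z + w).
Proof.
move=> oO [v0 Ov0]; have [e e0 he] := open_normP oO Ov0.
have [c c0 hc] := @linear_lipschitz_fin R E _ (to_intl S).
have [c' c'0 hc'] := @linear_lipschitz_fin R E _ (to_phys S).
pose s := 1 + \sum_i `|b`_(i : 'I_k)|.
have s0 : 0 < s by rewrite ltr_pwDl// sumr_ge0.
(* The mesh [1 / N] keeps the internal part of the error [d] below [e / 2]. *)
pose N' := Num.truncn (c * s / (e / 2)); pose N := N'.+1.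
have N0 : 0 < N%:R :> R by rewrite ltr0n.
pose rho (u : {ffun 'I_k -> 'I_N'.+1}) : E :=
  \sum_i ((u i : nat)%:R / N%:R) *: b`_(i : 'I_k).
have /choice[g hg] : forall u, exists z, `|lattice_intl z - (v0 + to_intl S (rho u))| < e / 2.
  move=> u; have [||v [/= vo [x Sx vE]]] := @proj_intl_dense _ _ S
    [set v | `|v - (v0 + to_intl S (rho u))| < e / 2].
  - by exists (v0 + to_intl S (rho u)); rewrite /= subrr normr0 divr_gt0.
  - exact: open_dist_ball.
  by have [z xz] := (latticeP x).1 Sx; exists z; rewrite /lattice_intl /= -xz /to_intl vE.
exists (\sum_u (`|lattice_phys (g u)| + `|to_phys S (rho u)|) + c' * s) => x w.
pose y := vsval x - vsval w.
have to_physy : to_phys S y = x.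
  rewrite /y to_physB /to_phys proj_along_id ?phys_cap_intl//.
  by rewrite proj_along_eq0 ?subr0 ?phys_add_intl ?phys_cap_intl.
have to_intly : to_intl S y = - w.
  rewrite /y to_intlB /to_intl proj_along_id; last by rewrite capvC phys_cap_intl.
  by rewrite proj_along_eq0 ?sub0r ?[(intl S + _)%VS]addvC ?phys_add_intl// capvC phys_cap_intl.
pose t i := coord b i y.
pose fl i := Num.floor (N%:R * t i).
have ri i : (`|(fl i %% N%:Z)%Z|%N < N'.+1)%N by lia.
pose u := [ffun i => Ordinal (ri i)].
pose z0 : G := [ffun i => (fl i %/ N%:Z)%Z].
pose d := y - lattice_point z0 - rho u.
have dn : `|d| <= s / N%:R.
  have -> : d = \sum_i (t i - (fl i)%:~R / N%:R) *: b`_i.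
    have yS : y = \sum_i t i *: b`_i := coord_basis b_basis (memvf y).
    rewrite /d /rho [X in X - _ - _]yS /lattice_point -!sumrB.
    apply: eq_bigr => i _; rewrite !ffunE /= -scaler_int -!scalerBl; congr (_ *: _).
    rewrite -/(t i) [in RHS](divz_eq (fl i) N%:Z) intrD intrM mulrDl.
    rewrite mulfK ?gt_eqF// opprD addrA; congr (_ - _ / _).
    by rewrite natr_absz ger0_norm// modz_ge0.
  apply: le_trans (ler_norm_sum _ _ _) _; rewrite /s mulrC mulrDr mulr_sumr.
  apply: ler_wpDl; first by rewrite mulr1 invr_ge0 ltW.
  apply: ler_sum => i _; rewrite normrZ ler_wpM2r//.
  have -> : t i - (fl i)%:~R / N%:R = (N%:R * t i - (fl i)%:~R) / N%:R.
    by rewrite mulrBl mulrAC divff ?gt_eqF// mul1r.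
  rewrite normrM.
  have Ni : 0 <= N%:R^-1 :> R by rewrite invr_ge0 ltW.
  rewrite [X in _ * X](ger0_norm Ni); apply: ler_piMl => //.
  have /andP[h1 h2] := floor_itv (N%:R * t i).
  rewrite ger0_norm ?subr_ge0//; move: h2; rewrite intrD lerBlDl addrC.
  by move=> /ltW.
have sN : c * (s / N%:R) < e / 2.
  rewrite mulrA ltr_pdivrMr// -ltr_pdivrMl ?divr_gt0// mulrC.
  exact: truncnS_gt.
have yE : y = lattice_point z0 + rho u + d by rewrite /d; zmod.
have lD z z' : lattice_point (z + z') = lattice_point z + lattice_point z' by exact: raddfD.
exists (z0 + g u).
  have -> : lattice_phys (z0 + g u) - x =
      lattice_phys (g u) - to_phys S (rho u) - to_phys S d.
    by rewrite -to_physy yE /lattice_phys /= lD !to_physD; zmod.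
  apply: le_trans (ler_normB _ _) _; rewrite lerD//.
    apply: le_trans (ler_normB _ _) _; rewrite (bigD1 u)//= lerDl.
    by apply: sumr_ge0 => i _; rewrite addr_ge0.
  apply: le_trans (hc' _) _; rewrite ler_pM2l//; apply: le_trans dn _.
  by rewrite ler_pdivrMr// ler_peMr ?ler1n// ltW.
have lE : lattice_intl (z0 + g u) + w = lattice_intl (g u) - to_intl S (rho u) - to_intl S d.
  have -> : w = - to_intl S y by rewrite to_intly opprK.
  by rewrite yE /lattice_intl /= lD !to_intlD; zmod.
apply: he; rewrite lE.
have -> : v0 - (lattice_intl (g u) - to_intl S (rho u) - to_intl S d) =
    to_intl S d - (lattice_intl (g u) - (v0 + to_intl S (rho u))) by zmod.
apply: le_lt_trans (ler_normB _ _) _; rewrite [ltRHS]splitr ltrD//.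
apply: le_lt_trans (hc _) _; apply: le_lt_trans sN.
by rewrite ler_pM2l.
Qed.

End Lattice.

(** * Expansive maps have exponentially contracting inverse iterates *)

Section Contraction.
Context (R : realType).
Local Notation normc := (@Normc.normc R).

Lemma normc_ge0 (z : R[i]) : 0 <= normc z.
Proof. by case: z => a b; exact: sqrtr_ge0. Qed.

(* Splitting off one factor [N - z%:M] at a time, as in solving the recurrence
   [z y_(k+1) = y_k - y'_(k+1)]. *)
Lemma backward_orbit_decay n (N : 'M[R[i]]_n.+1) (rho : R) (rs : seq R[i])
    (y : nat -> 'rV[R[i]]_n.+1) :
  0 < rho -> (forall z, z \in rs -> 1 < rho * normc z) ->
  (forall k, y k = y k.+1 *m N) ->
  (forall k, y k *m (\prod_(z <- rs) (N - z%:M)) = 0) ->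
  exists2 c : R, 0 <= c & forall k j, normc (y k 0 j) <= c * rho ^+ k.
Proof.
move=> rho0; elim: rs y => [|z rs IH] y hz hy h0.
  exists 0 => // k j; move: (h0 k); rewrite big_nil mulmx1 => ->.
  by rewrite mxE Normc.normc0 mul0r.
pose y' k := y k *m (N - z%:M).
have [||k|c c0 hc] := IH y'.
- by move=> t trs; apply: hz; rewrite inE trs orbT.
- move=> k; rewrite /y' [in LHS]hy -!mulmxA; congr (_ *m _).
  by rewrite mulmxBl mulmxBr scalar_mxC.
- by rewrite /y' -mulmxA; move: (h0 k); rewrite big_cons.
have z1 : 0 < rho * normc z - 1 by rewrite subr_gt0; apply: hz; rewrite mem_head.
have nz : 0 < normc z.
  rewrite lt_def normc_ge0 andbT; apply/eqP => nz0.
  by move: z1; rewrite nz0 mulr0 sub0r oppr_gt0 ltr10.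
pose K := \sum_j normc (y 0%N 0 j) + c * rho / (rho * normc z - 1).
have K0 : 0 <= K.
  rewrite addr_ge0//; first by apply: sumr_ge0 => j _; exact: normc_ge0.
  by rewrite divr_ge0 ?mulr_ge0// ltW.
have cK : c * rho <= K * (rho * normc z - 1).
  rewrite -ler_pdivrMr// /K lerDr; apply: sumr_ge0 => j _; exact: normc_ge0.
exists K => //; elim=> [|k IHk] j.
  rewrite expr0 mulr1 /K (bigD1 j)//= -addrA lerDl addr_ge0//.
    by apply: sumr_ge0 => i _; exact: normc_ge0.
  by rewrite divr_ge0 ?mulr_ge0// ltW.
have e : z * y k.+1 0 j = y k 0 j - y' k.+1 0 j.
  rewrite /y' mulmxBr -hy mul_mx_scalar !mxE opprB addrC subrK //.
have : normc (z * y k.+1 0 j) <= K * rho ^+ k + c * rho ^+ k.+1.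
  rewrite e; apply: le_trans (le_normcD _ _) _.
  by rewrite normcN lerD.
rewrite Normc.normcM -ler_pdivlMl// => /le_trans; apply.
rewrite mulrC ler_pdivrMr// exprS.
have : 0 <= rho ^+ k by rewrite exprn_ge0// ltW.
move: cK; set t := rho ^+ k; set nz_ := normc z => cK t0.
have -> : K * (rho * t) * nz_ = K * (rho * nz_) * t by ring.
have -> : K * t + c * (rho * t) = (K + c * rho) * t by ring.
by rewrite ler_wpM2r//; lra.
Qed.

(** By Cayley-Hamilton the product over all eigenvalues annihilates every row. Since there are
    finitely many, one [rho] below 1 serves them all. *)
Lemma backward_orbit_decay_expansive n (N : 'M[R[i]]_n) :
  (forall z, eigenvalue N z -> 1 < `|z|) ->
  exists rho : R, [/\ 0 <= rho, rho < 1 & forall y : nat -> 'rV[R[i]]_n,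
    (forall k, y k = y k.+1 *m N) ->
    exists2 c : R, 0 <= c & forall k j, normc (y k 0 j) <= c * rho ^+ k].
Proof.
case: n N => [|n] N hN.
  by exists 0; split=> // y _; exists 0 => // k [].
have [rs] := closed_field_poly_normal (char_poly N).
rewrite (eqP (char_poly_monic N)) scale1r => rsE.
have hrs z : z \in rs -> 1 < normc z.
  move=> zrs; have : 1 < `|z|.
    by apply: hN; rewrite eigenvalue_root_char rsE root_prod_XsubC.
  by rewrite normc_def ltcR; case: z {zrs}.
have [rho [rho0 rho1 hrho]] : exists rho : R,
    [/\ 0 < rho, rho < 1 & forall z, z \in rs -> 1 < rho * normc z].
  elim: rs hrs {rsE} => [|z rs IH] hrs.
    by exists (1 / 2); split=> //; lra.
  have [t trs|rho [rho0 rho1 hrho]] := IH; first by apply: hrs; rewrite inE trs orbT.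
  have z1 : 1 < normc z by apply: hrs; rewrite mem_head.
  have z0 : 0 < normc z by apply: lt_trans z1.
  pose s := (1 + (normc z)^-1) / 2.
  have i1 : (normc z)^-1 < 1 by rewrite invf_lt1.
  have i0 : 0 < (normc z)^-1 by rewrite invr_gt0.
  exists (Num.max rho s); split.
  - by rewrite lt_max rho0.
  - by rewrite gt_max rho1 /s; lra.
  - move=> t; rewrite inE => /orP[/eqP ->|/hrho h].
      apply: (@lt_le_trans _ _ (s * normc z)).
        by rewrite /s mulrAC ltr_pdivlMr// mul1r mulrDl mul1r mulVf ?gt_eqF//; lra.
      by rewrite ler_wpM2r ?(ltW z0)// le_max lexx orbT.
    apply: lt_le_trans h _.
    by rewrite ler_wpM2r ?normc_ge0// le_max lexx.
exists rho; split=> //; first exact: ltW.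
move=> y hy; apply: (backward_orbit_decay rho0 hrho hy) => k.
have := Cayley_Hamilton N; rewrite rsE rmorph_prod /=.
under eq_bigr do rewrite rmorphB /= horner_mx_X horner_mx_C.
by move=> ->; rewrite mulmx0.
Qed.

(** Decay along single orbits becomes a uniform bound by expanding in a basis. *)
Lemma expansive_contract (U : finNormedModType R) (f : 'End(U)) :
  automorphism f -> expansive f -> exists K rho : R,
  [/\ 0 <= K, 0 <= rho, rho < 1 &
      forall n x, `|iter n f^-1%VF x| <= K * rho ^+ n * `|x|].
Proof.
move=> fa fe; have /lker0_lfunVK fVK := fa.
pose e := vbasis {:U}.
have eb : basis_of {:U} e := vbasisP _.
suff [rho [rho0 rho1 hrho]] : exists rho : R, [/\ 0 <= rho, rho < 1 & forall x,
    exists2 c : R, 0 <= c & forall k i, `|coord e i (iter k f^-1%VF x)| <= c * rho ^+ k].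
  have /choice[c hc] : forall x, exists c : R, 0 <= c /\
      forall k, `|iter k f^-1%VF x| <= c * rho ^+ k.
    move=> x; have [c c0 hc] := hrho x; exists (c * \sum_(i < \dim {:U}) `|e`_i|).
    split=> [|k]; first by rewrite mulr_ge0// sumr_ge0.
    rewrite [X in `|X|](coord_basis eb (memvf _)).
    apply: le_trans (ler_norm_sum _ _ _) _; rewrite mulrAC mulr_sumr.
    by apply: ler_sum => i _; rewrite normrZ ler_wpM2r.
  have [K K0 hK] := coord_bounded U.
  exists (K * \sum_(i < \dim {:U}) c e`_i), rho; split=> //.
    by rewrite mulr_ge0 ?(ltW K0)// sumr_ge0// => i _; have [] := hc e`_i.
  move=> n x; rewrite [x in iter n _ x](coord_basis eb (memvf x)).
  have -> : iter n f^-1%VF (\sum_(i < \dim {:U}) coord e i x *: e`_i) =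
      \sum_(i < \dim {:U}) coord e i x *: iter n f^-1%VF e`_i.
    elim: n => //= n ->; rewrite linear_sum; apply: eq_bigr => i _.
    by rewrite linearZ.
  apply: le_trans (ler_norm_sum _ _ _) _.
  rewrite mulr_sumr !mulr_suml; apply: ler_sum => i _; rewrite normrZ.
  have [ci0 /(_ n) h] := hc e`_i.
  have -> : K * c e`_i * rho ^+ n * `|x| = (K * `|x|) * (c e`_i * rho ^+ n) by ring.
  by apply: ler_pM.
pose y x k := map_mx (real_complex R) (passmx.rVof e (iter k f^-1%VF x)).
have [rho [rho0 rho1 h]] := backward_orbit_decay_expansive fe.
exists rho; split=> // x; have [k|c c0 hc] := h (y x).
  rewrite /y -map_mxM -passmx.rVof_app// -[in LHS](fVK (iter k f^-1%VF x)) //.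
exists c => // k i; rewrite passmx.coord_rVof//.
by have := hc k i; rewrite !mxE /= expr0n addr0 sqrtr_sqr.
Qed.
End Contraction.

(** * Bounds and bounding hyperplanes of polytopal windows *)

Section PolytopalWindows.
Context (R : realType) (V : finNormedModType R) (l : nat) (W : colored V l).

Lemma window_closed : window W -> forall i, closed (W i).
Proof. by move=> h i; apply: compact_closed (norm_hausdorff (V := V)) _; have [] := h i. Qed.

Lemma window_bounded : window W -> exists B : R, forall i x, W i x -> `|x| <= B.
Proof.
move=> h; have /choice[B hB] : forall i, exists B : R, forall x, W i x -> `|x| <= B.
  move=> i; have /compact_bounded [B [_ hB]] := (h i).1.
  by exists (B + 1) => x Wx; apply: hB => //; rewrite ltrDl.
exists (\sum_i `|B i|) => i x /hB xB; apply: le_trans xB _.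
by rewrite (bigD1 i)//= (le_trans (ler_norm _))// lerDl sumr_ge0.
Qed.

Lemma Ver_interior_nonempty x : window W -> Ver W x -> exists i, (W i)° !=set0.
Proof.
move=> h [i _ [[clx _] _]]; exists i.
have : W i x by apply: window_closed.
by rewrite {1}(h i).2 => /closure_normP /(_ 1 ltr01) [y Wy _]; exists y.
Qed.

Lemma polytopal_hyperplanes : polytopal_window W ->
  exists Hs : seq ('Hom(V, R^o) * R),
    (forall i x, boundary (W i) x -> exists2 h, h \in Hs & h.1 x = h.2) /\
    (forall h, h \in Hs -> h.1 != 0).
Proof.
move=> [_ h]; have /choice[s hs] : forall i, exists s : seq ('Hom(V, R^o) * R),
    (forall x, boundary (W i) x -> exists2 h, h \in s & h.1 x = h.2) /\
    (forall h, h \in s -> h.1 != 0).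
  move=> i; have [Hs /finite_seqP[t ->] [supp bd]] := h i.
  have /choice[f hf] : forall H : set V, exists f : 'Hom(V, R^o) * R,
      H \in t -> f.1 != 0 /\ H = [set x | f.1 x = f.2].
    move=> H; have [Ht|] := boolP (H \in t); last by exists (0, 0).
    by have [w [U [Hp [_ _ [phi [c [phi0 HE _]]] _]]]] := supp H Ht; exists (phi, c).
  exists (map f t); split=> [x /bd[H Ht Hx]|_ /mapP[H Ht ->]]; last by have [] := hf H Ht.
  exists (f H); first exact: map_f.
  by move: Hx; have [_ {1}->] := hf H Ht.
exists (flatten [seq s i | i <- enum 'I_l]); split=> [i x bx|h0].
  have [h0 h0s h0x] := (hs i).1 x bx; exists h0 => //.
  by apply/flattenP; exists (s i) => //; rewrite map_f// mem_enum.
by move=> /flattenP[_ /mapP[i _ ->]]; have [_] := hs i; apply.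
Qed.

Lemma boundary_translate s i x :
  boundary (translate W s i) x <-> boundary (W i) (x - s).
Proof.
have tr (y : V) (e : R) (A : set V) : (forall z, `|y - z| < e -> A (z - s)) <->
    (forall z, `|y - s - z| < e -> A z).
  split=> ha z hz; last by apply: ha; rewrite opprB addrA subrK.
  by rewrite -[z](addrK s); apply: ha; rewrite opprD [- z - s]addrC addrA.
split=> -[/closure_normP cl ni]; split.
- apply/closure_normP => e e0; have [y /translateE Wy xy] := cl e e0.
  by exists (y - s) => //; rewrite opprB addrA subrK.
- move=> /interior_normP[e e0 he]; apply/ni/interior_normP; exists e => // y xy.
  by apply/translateE; apply: ((tr x e (W i)).2 he).
- apply/closure_normP => e e0; have [y Wy xy] := cl e e0.
  exists (y + s); first by apply/translateE; rewrite addrK.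
  by rewrite opprD [- y - s]addrC addrA.
- move=> /interior_normP[e e0 he]; apply/ni/interior_normP; exists e => //.
  by apply/tr => z /he /translateE.
Qed.

End PolytopalWindows.

(** * From the cut and project scheme and its torus to abstract parameters *)

Section Bridge.
Context (R : realType) (E : finNormedModType R) (S : cps E).
Context (b : (\dim {:E}).-tuple E) (b_basis : basis_of {:E} b).
Hypothesis lattice_b : lattice S = inIntSpan b.
Context (l : nat) (W : colored (subvs_of (intl S)) l).

Local Notation p := (lattice_phys S b).
Local Notation q := (lattice_intl S b).

Lemma nonsingular_windowE s :
  nonsingular_window (translate W s) <-> nonsing q W (- s).
Proof.
split=> [h i g bd|h i].
  suff : set0 (q g) by [].
  rewrite -(h i); split; last exact/boundary_translate.
  by exists (lattice_point b g) => //; exact: lattice_point_lattice.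
apply/seteqP; split=> // v [[x /(latticeP lattice_b)[g ->] <-]].
by move=> /boundary_translate; exact: h.
Qed.

Lemma model_set_translate s : model_set (translate W s) = model p q W 0 (- s).
Proof.
apply: colored_ext => i y; split=> [[x [/(latticeP lattice_b)[g ->]]]|[g Wg <-]].
  by move=> /translateE Wg <-; exists g => //; rewrite addr0.
exists (lattice_point b g); last by rewrite addr0.
by split; [exact: lattice_point_lattice | exact/translateE].
Qed.

Lemma OmegaE P : Omega W P <-> in_hull p q W P.
Proof.
split=> [[s ns [dP]]|[dP [w nw lP]]].
  rewrite model_set_translate => lP; split=> //; exists (- s) => //.
  exact/nonsingular_windowE.
exists (- w); first by apply/nonsingular_windowE; rewrite opprK.
by split=> //; rewrite model_set_translate opprK.
Qed.

Lemma model_set_atE x : model_set_at W x = model p q W (to_phys S x) (to_intl S x).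
Proof.
apply: colored_ext => i y; split=> [[z [/(latticeP lattice_b)[g ->] Wg <-]]|[g Wg <-]].
  by rewrite to_physD; exists g => //; move: Wg; rewrite to_intlD.
exists (lattice_point b g); rewrite ?to_physD//=.
by split; [exact: lattice_point_lattice | rewrite to_intlD].
Qed.

Lemma nonsingular_pointE x : nonsingular_point W x <-> nonsing q W (to_intl S x).
Proof.
split=> [h i g bd|h [i _ [_ [z /(latticeP lattice_b)[g ->] <-] [y by_ yx]]]].
  apply: h; exists i => //; exists (to_intl S (lattice_point b (- g))).
    by exists (lattice_point b (- g)) => //; exact: lattice_point_lattice.
  exists (q g + to_intl S x) => //.
  by rewrite [to_intl S (lattice_point b _)](raddfN q) addrAC subrr add0r.
apply: (h i (- g)); rewrite raddfN -yx /lattice_intl /= addrCA addNr addr0 //.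
Qed.

Lemma torus_class_latticeD x g : torus_class S (x + lattice_point b g) = torus_class S x.
Proof.
apply/eqmodP/asboolP; rewrite addrC addrA addNr add0r || rewrite addrAC subrr add0r.
exact: lattice_point_lattice.
Qed.

Lemma torus_class_open u (e : R) :
  open [set t | exists2 x, t = torus_class S x & `|x - u| < e].
Proof.
rewrite /open /= /quotient_open openE => x /= [y xy yu].
apply/interior_normP; exists (e - `|y - u|); first by rewrite subr_gt0.
move=> z xz; exists (z + (y - x)).
  have /eqmodP/asboolP/(latticeP lattice_b)[g xyg] := xy.
  apply/esym.
  rewrite -[RHS](torus_class_latticeD _ (- g)); congr torus_class.
  by rewrite raddfN /= -xyg; zmod.
have -> : z + (y - x) - u = (y - u) - (x - z) by zmod.
by apply: le_lt_trans (ler_normB _ _) _; rewrite -ltrBrDl.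
Qed.

Lemma to_phys_intl x w : to_phys S (vsval x + vsval w) = x /\
  to_intl S (vsval x + vsval w) = w.
Proof.
rewrite to_physD to_intlD /to_phys /to_intl.
have cap := phys_cap_intl S; have add := phys_add_intl S.
rewrite !proj_along_id ?[(intl S :&: _)%VS]capvC// !proj_along_eq0 ?[(intl S :&: _)%VS]capvC//.
  by rewrite addr0 add0r.
by rewrite addvC.
Qed.

Section Torus.
Context (tau : colored (subvs_of (phys S)) l -> torus S).
Hypothesis tau_param : torus_parametrisation W tau.
Context (B : R).
Hypothesis W_bounded : forall i x, W i x -> `|x| <= B.
Hypothesis W_nonempty : exists i, (W i)° !=set0.

Let model_hull := model_in_hull (lattice_phys_intl_finite S b_basis)
  (lattice_phys_inj b_basis lattice_b) (lattice_relatively_dense b_basis lattice_b)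
  W_bounded W_nonempty.

(** Continuity of [tau] at [P], tested on a non-singular model set that agrees with [P] on a large
    ball. A lattice shift brings its parameter near [u]. *)
Lemma torus_near P u (r e : R) : in_hull p q W P -> tau P = torus_class S u ->
  0 < e -> exists y, [/\ nonsing q W (to_intl S y), `|y - u| < e &
    agree r P 0 (model p q W (to_phys S y) (to_intl S y)) 0].
Proof.
move=> hP tP e0; have [cont val] := tau_param.
have OP : Omega W P by exact/OmegaE.
have /(cont _ OP) [r0 [e1 [r00 e10 h]]] :
    nbhs (tau P) [set t | exists2 x, t = torus_class S x & `|x - u| < e].
  apply: open_nbhs_nbhs; split; first exact: torus_class_open.
  by exists u; rewrite ?tP// subrr normr0.
have [dP [w nw lP]] := hP.
have [t ag] := LI_at (Num.max r r0) 0 lP.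
pose x := vsval (- t) + vsval w.
have [xp xi] := to_phys_intl (- t) w.
have {}ag : agree (Num.max r r0) P 0 (model_set_at W x) 0.
  rewrite model_set_atE xp xi; apply: agree_trans ag _; apply: agree_sym.
  have := agree_model_translate p q W 0 (- t) w (r := Num.max r r0) t.
  by rewrite subrr add0r.
have nx : nonsingular_point W x by apply/nonsingular_pointE; rewrite xi.
have [||| y xy yu] := h (model_set_at W x) 0.
- by rewrite normr0 ltW.
- rewrite translate0; apply/central_patchP.
  by apply: agree_le ag; rewrite le_max lexx orbT.
- apply/OmegaE; rewrite model_set_atE xi; exact: model_hull.
move: xy; rewrite (val _ nx) => /eqmodP/asboolP/(latticeP lattice_b)[g xyg].
have yE : y = x + lattice_point b (- g) by rewrite raddfN /= -xyg; zmod.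
have ypE : to_phys S y = to_phys S x + p (- g) by rewrite yE to_physD.
have yiE : to_intl S y = to_intl S x + q (- g) by rewrite yE to_intlD.
exists y; split=> //; first by rewrite yiE xi; exact: nonsing_shift.
rewrite ypE yiE model_shift -model_set_atE.
by apply: agree_le ag; rewrite le_max lexx.
Qed.

(** [torus_near] gives a physical part near that of [u], while [approx] wants equality. A fixed
    point [y0] of [P] is compared with finitely many positions over [u]; those different from [y0]
    are at distance more than [e], so closeness forces equality. *)
Lemma torus_approx P u : in_hull p q W P -> tau P = torus_class S u ->
  approx p q W P (to_phys S u) (to_intl S u).
Proof.
move=> hP tP.
have [y0 [i0 _ Py0]] : exists y, (\bigcup_i P i) y.
  by have [[_ [c hc]] _] := hP; have [y Py _] := hc 0; exists y.
have [cp cp0 hcp] := @linear_lipschitz_fin R E _ (to_phys S).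
have [ci ci0 hci] := @linear_lipschitz_fin R E _ (to_intl S).
pose D := [set g | `|p g + to_phys S u| <= `|y0| + cp /\
  `|q g + to_intl S u| <= B + ci].
have [|g _||e e0 he] := @finite_min R _ D
    (fun g e => p g + to_phys S u != y0 -> e < `|p g + to_phys S u - y0|).
- exact: lattice_near_finite (lattice_phys_intl_finite S b_basis) _ _ _ _.
- have [->|ne] := eqVneq (p g + to_phys S u) y0; first by exists 1.
  exists (`|p g + to_phys S u - y0| / 2).
    by rewrite divr_gt0// normr_gt0 subr_eq0.
  by move=> _; rewrite ltr_pdivrMr// ltr_pMr ?ltr1n// normr_gt0 subr_eq0.
- by move=> g e e' _ ee h /h; exact: le_lt_trans.
move=> r e1 e10.
pose e2 := Num.min 1 (Num.min (e / cp) (e1 / ci)).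
have [|y [ny yu ag]] := @torus_near P u (Num.max r `|y0|) e2 hP tP.
  by rewrite !lt_min ltr01 !divr_gt0.
have ye t : e2 <= t -> `|y - u| < t by apply: lt_le_trans.
have y1 : `|y - u| < 1 by apply: ye; rewrite /e2 ge_min lexx.
have yp : `|to_phys S y - to_phys S u| < e.
  rewrite -to_physB; apply: le_lt_trans (hcp _) _; rewrite -ltr_pdivlMl// mulrC.
  by apply: ye; rewrite /e2 !ge_min lexx !orbT.
have yi : `|to_intl S y - to_intl S u| < e1.
  rewrite -to_intlB; apply: le_lt_trans (hci _) _; rewrite -ltr_pdivlMl// mulrC.
  by apply: ye; rewrite /e2 !ge_min lexx !orbT.
have [g /= Wg gy0] : model p q W (to_phys S y) (to_intl S y) i0 y0.
  rewrite -[y0]add0r; apply/(ag y0 i0); first by rewrite le_max lexx orbT.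
  by rewrite add0r.
have ypu : to_phys S y = to_phys S u.
  have Dg : D g.
    split.
      have -> : p g + to_phys S u = y0 - to_phys S (y - u).
        by rewrite -gy0 to_physB; zmod.
      apply: le_trans (ler_normB _ _) _; rewrite lerD2l.
      by apply: le_trans (hcp _) _; rewrite ler_piMr ?ltW.
    have -> : q g + to_intl S u = (q g + to_intl S y) - to_intl S (y - u).
      by rewrite to_intlB; zmod.
    apply: le_trans (ler_normB _ _) _; rewrite lerD ?(W_bounded Wg)//.
    by apply: le_trans (hci _) _; rewrite ler_piMr ?ltW.
  suff : p g + to_phys S u = y0 by rewrite -gy0 => /addrI.
  apply: contrapT => /eqP /(he g Dg); rewrite ltNge => /negP; apply.
  rewrite -gy0 (_ : _ - _ = - (to_phys S y - to_phys S u)); last by zmod.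
  by rewrite normrN ltW.
exists (to_intl S y); split=> //.
rewrite -ypu; apply: agree_le ag; by rewrite le_max lexx.
Qed.

End Torus.

End Bridge.

(** * Rational internal parameters and periodicity *)

Section LatticeEndomorphism.
Context (R : realType) (E : finNormedModType R) (S : cps E).
Context (b : (\dim {:E}).-tuple E) (b_basis : basis_of {:E} b).
Hypothesis lattice_b : lattice S = inIntSpan b.
Local Notation k := (\dim {:E}).

Lemma coord_basis_inj (x y : E) : (forall i, coord b i x = coord b i y) -> x = y.
Proof.
move=> xy; rewrite (coord_basis b_basis (memvf x)) (coord_basis b_basis (memvf y)).
by apply: eq_bigr => i _; rewrite xy.
Qed.

(** In a lattice basis [f] is an integer matrix. Injectivity on the lattice excludes integer kernel
    vectors, so the determinant is non-zero, and the adjugate inverts [f] up to it. *)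
Lemma lattice_endo_invertible (f : 'End(E)) :
  (forall x, lattice S x -> lattice S (f x)) ->
  (forall x, lattice S x -> f x = 0 -> x = 0) ->
  (forall x, f x = 0 -> x = 0) /\
  forall x, lattice S x -> exists2 N : nat, (0 < N)%N &
    exists2 y, lattice S y & f y = N%:R *: x.
Proof.
move=> fS f0.
have /choice[T hT] : forall z, exists z', lattice_point b z' = f (lattice_point b z).
  move=> z; have /(latticeP lattice_b)[z' ->] := fS _ (lattice_point_lattice lattice_b z).
  by exists z'.
pose N : 'M[int]_k := \matrix_(i, j) T [ffun i' => (i == i')%:Z] j.
have cf x j : coord b j (f x) = \sum_i coord b i x * (N i j)%:~R.
  rewrite [x in LHS](coord_basis b_basis (memvf x)) !linear_sum.
  apply: eq_bigr => i _; rewrite !linearZ /= mxE; congr (_ * _).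
  rewrite -(coord_lattice_point b_basis) hT; congr (coord b j (f _)).
  rewrite /lattice_point (bigD1 i)//= ffunE eqxx mulr1z big1 ?addr0// => i' ii'.
  by rewrite ffunE eq_sym (negbTE ii') mulr0z.
have cfz (v : 'rV[int]_k) j :
    coord b j (f (lattice_point b [ffun i => v 0 i])) = ((v *m N) 0 j)%:~R.
  rewrite cf mxE rmorph_sum; apply: eq_bigr => i _.
  by rewrite (coord_lattice_point b_basis) ffunE rmorphM.
have detN : \det N != 0.
  apply/negP => /det0P[v v0 vN]; move/negP: v0; apply; apply/eqP/rowP => i.
  have h : lattice_point b [ffun i => v 0 i] = 0.
    apply: f0; first exact: lattice_point_lattice.
    by apply: coord_basis_inj => j; rewrite cfz vN !mxE linear0.
  have := coord_lattice_point b_basis [ffun i => v 0 i] i.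
  rewrite h linear0 ffunE => /esym/eqP; rewrite intr_eq0 => /eqP ->.
  by rewrite mxE.
split=> [x fx|x /(latticeP lattice_b)[z ->]].
  have detNR : \det (map_mx (intr : int -> R) N) != 0.
    by rewrite det_map_mx intr_eq0.
  pose c : 'rV[R]_k := \row_i coord b i x.
  have c0 : c = 0.
    apply/eqP/negPn/negP => c0; move/negP: detNR; apply; apply/det0P; exists c => //.
    apply/rowP => j; rewrite !mxE; transitivity (coord b j (f x)).
      rewrite cf; apply: eq_bigr => i _; rewrite !mxE //.
    by rewrite fx linear0.
  apply: coord_basis_inj => i; rewrite linear0.
  by have := congr1 (fun c : 'rV_k => c 0 i) c0; rewrite !mxE.
exists `|\det N|%N; first by rewrite absz_gt0.
(* The sign turns the multiplier into the positive number [|\det N|]. *)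
pose v := sgz (\det N) *: ((\row_i z i) *m \adj N).
exists (lattice_point b [ffun i => v 0 i]); first exact: lattice_point_lattice.
apply: coord_basis_inj => j; rewrite cfz linearZ /= (coord_lattice_point b_basis).
rewrite /v -scalemxAl -mulmxA mul_adj_mx mul_mx_scalar scalerA -abszEsg.
by rewrite !mxE intrM.
Qed.

Context (M : 'End(E)) (M_auto : automorphism M).
Hypothesis M_lattice : M @` lattice S = lattice S.
Hypotheses (M_phys : (M @: phys S)%VS = phys S) (M_intl : (M @: intl S)%VS = intl S).
Local Notation L := (restr (phys S) M).
Local Notation A := (restr (intl S) M).
Local Notation p := (lattice_phys S b).
Local Notation q := (lattice_intl S b).

Lemma lattice_automorphism : exists m,
  [/\ forall z, lattice_point b (m z) = M (lattice_point b z),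
      forall z, p (m z) = L (p z), forall z, q (m z) = A (q z) &
      forall z, exists z', m z' = z].
Proof.
have /choice[m hm] : forall z, exists z', lattice_point b z' = M (lattice_point b z).
  move=> z; have : lattice S (M (lattice_point b z)).
    by rewrite -M_lattice; exists (lattice_point b z) => //; exact: lattice_point_lattice.
  by move=> /(latticeP lattice_b)[z' ->]; exists z'.
exists m; split=> // z.
- rewrite /lattice_phys /= hm; apply: restr_proj => //.
  + exact: phys_add_intl. + exact: phys_cap_intl.
- rewrite /lattice_intl /= hm; apply: restr_proj => //.
  + by rewrite addvC phys_add_intl. + by rewrite capvC phys_cap_intl.
- have := lattice_point_lattice lattice_b z; rewrite -M_lattice.
  move=> [_ /(latticeP lattice_b)[z' ->] e]; exists z'.
  by apply: (lattice_point_inj b_basis); rewrite hm.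
Qed.

(** [M] permutes the finitely many torsion points of given order: coordinates modulo the denominator
    repeat, and invertibility of [m] moves the repetition to the start. *)
Lemma rational_periodic w n : rational_intl S w -> (0 < n)%N ->
  exists2 i, (0 < i)%N & exists g, iter (n * i) A w = w + q g.
Proof.
move=> [N [x [N0 /(latticeP lattice_b)[z ->] ->]]] n0.
have [m [mE _ q_m m_surj]] := lattice_automorphism.
have m_inj : injective m.
  move=> z1 z2 /(congr1 (lattice_point b)); rewrite !mE => /(lker0P M_auto).
  exact: (lattice_point_inj b_basis).
have mD z1 z2 : m (z1 + z2) = m z1 + m z2.
  apply: (lattice_point_inj b_basis); rewrite mE !(raddfD (lattice_point b)) /=.
  by rewrite homD !mE.
case: N N0 => // N _.
have bnd (v : int) : (`|(v %% N.+1%:Z)%Z|%N < N.+1)%N by lia.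
pose h j : {ffun 'I_k -> 'I_N.+1} := [ffun i => Ordinal (bnd (iter (n * j) m z i))].
have [j1 [j2 [j12 hj]]] : exists j1 j2, (j1 < j2)%N /\ h j1 = h j2.
  apply: contrapT => nh.
  have hinj : injective (fun i : 'I_(#|{ffun 'I_k -> 'I_N.+1}|.+1) => h i).
    move=> i j hij; apply/eqP/negPn/negP => ij; apply: nh.
    have : (i < j)%N \/ (j < i)%N by apply/orP; rewrite -neq_ltn.
    by case=> ?; [exists i, j | exists j, i].
  have := leq_card _ hinj; rewrite card_ord ltnn //.
have [g1 hg1] : exists g1, iter (n * j2) m z = iter (n * j1) m z + g1 *+ N.+1.
  exists [ffun i => ((iter (n * j2) m z i - iter (n * j1) m z i) %/ N.+1%:Z)%Z].
  apply/ffunP => i; have := congr1 (fun f : {ffun 'I_k -> 'I_N.+1} => f i : nat) hj.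
  rewrite !ffunE /= ffunMnE ffunE => /(congr1 Posz).
  rewrite !gez0_abs ?modz_ge0// => e.
  rewrite -mulr_natr natz divzK; first by rewrite addrC subrK.
  by rewrite -eqz_mod_dvd e.
have [g hg] : exists g, iter (n * j1) m g = g1.
  elim: (n * j1)%N (g1) => [|j IH] g'; first by exists g'.
  by have [g2 <-] := m_surj g'; have [g3 <-] := IH g2; exists g3.
have itD j z1 z2 : iter j m (z1 + z2) = iter j m z1 + iter j m z2.
  by elim: j => //= j ->; rewrite mD.
have it_inj j : injective (iter j m) by elim: j => //= j IH z1 z2 /m_inj /IH.
have it0 j : iter j m 0 = 0 by apply: (addIr (iter j m 0)); rewrite -itD !add0r.
have itMn j z1 c : iter j m (z1 *+ c) = iter j m z1 *+ c.
  by elim: c => [|c IH]; rewrite ?mulr0n ?it0// !mulrS itD IH.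
have zg : iter (n * (j2 - j1)) m z = z + g *+ N.+1.
  apply: (it_inj (n * j1)%N); rewrite itD itMn hg -hg1 -iterD -mulnDr subnKC//.
  exact: ltnW.
exists (j2 - j1)%N; first by rewrite subn_gt0.
exists g; rewrite iter_homZ.
have -> : iter (n * (j2 - j1)) A (to_intl S (lattice_point b z)) =
    q (iter (n * (j2 - j1)) m z).
  by elim: (n * (j2 - j1))%N => //= j ->; rewrite q_m.
rewrite zg raddfD raddfMn /= scalerDr; congr (_ + _).
by rewrite -[X in _ *: X]scaler_nat scalerA mulVf ?scale1r// pnatr_eq0.
Qed.

Context (K rho : R) (K0 : 0 <= K) (rho0 : 0 <= rho) (rho1 : rho < 1).
Hypothesis L_contract : forall n x, `|iter n L^-1%VF x| <= K * rho ^+ n * `|x|.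

(** A periodic point is fixed by arbitrarily high backward iterates, which shrink it by any
    factor. *)
Lemma expansive_fixed n x : (0 < n)%N -> iter n L x = x -> x = 0.
Proof.
move=> n0 fx; have La := restr_automorphism M_phys M_auto.
have gx j : iter (j * n) L^-1%VF x = x.
  elim: j => //= j IH; rewrite mulSn iterD IH -[in LHS]fx.
  exact: iter_cancel (lker0_lfunVK La) _ || exact: iter_cancel (lker0_lfunK La) _.
have [j hj] : exists j, rho ^+ j < (K + 1)^-1.
  have K1 : 0 < (K + 1)^-1 by rewrite invr_gt0 ltr_wpDl.
  have /cvgr0_norm_lt /(_ _ K1) [j _ /(_ j (leqnn j)) hj] :
    (rho ^+ j @[j --> \oo] --> (0 : R))%classic by apply: cvg_expr; rewrite ger0_norm.
  by exists j; apply: le_lt_trans (ler_norm _) hj.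
apply/eqP; rewrite -normr_le0 leNgt; apply/negP => x0.
have := L_contract (j * n) x; rewrite gx leNgt => /negP; apply.
rewrite gtr_pMl//; apply: (@le_lt_trans _ _ (K * (K + 1)^-1)).
  rewrite ler_wpM2l//; apply: le_trans (ltW hj).
  by rewrite ler_wiXn2l ?(ltW rho1)// leq_pmulr.
by rewrite ltr_pdivrMr ?ltr_wpDl// mul1r ltrDl.
Qed.

Lemma restr_iter n (x : subvs_of (intl S)) : vsval (iter n A x) = lfun_exp M n (vsval x).
Proof. by rewrite lfun_expE; elim: n => //= n <-; rewrite vsval_restr. Qed.

Lemma to_intl_exp n x : to_intl S (lfun_exp M n x) = iter n A (to_intl S x).
Proof.
rewrite lfun_expE; elim: n => //= n <-; apply: restr_proj => //.
  by rewrite addvC phys_add_intl.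
by rewrite capvC phys_cap_intl.
Qed.

Lemma to_phys_exp n x : to_phys S (lfun_exp M n x) = iter n L (to_phys S x).
Proof.
rewrite lfun_expE; elim: n => //= n <-; apply: restr_proj => //.
  exact: phys_add_intl.
exact: phys_cap_intl.
Qed.

Lemma lattice_exp n x : lattice S x -> lattice S (lfun_exp M n x).
Proof.
move=> Sx; rewrite lfun_expE; elim: n => //= n IH.
by rewrite -M_lattice; exists (iter n M x).
Qed.

(** That [A] has no root of unity as eigenvalue comes from the lattice: a lattice vector fixed by
    [M^n] has a physical part fixed by [L^n], hence zero. So [M^n - 1] is invertible, and some
    [N *: w] is the internal part of a lattice vector. *)
Lemma periodic_rational n w g : (0 < n)%N -> iter n A w = w + q g -> rational_intl S w.
Proof.
move=> n0 wg; pose f := (lfun_exp M n - \1)%VF.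
have fE x : f x = lfun_exp M n x - x by rewrite add_lfunE opp_lfunE id_lfunE.
have [||f0 fN] := @lattice_endo_invertible f.
- by move=> x Sx; rewrite fE; apply: latticeB => //; exact: lattice_exp.
- move=> x Sx; rewrite fE => /subr0_eq fx.
  apply: (@proj_phys_inj _ _ S); [exact/mem_set|exact/mem_set/lattice0|].
  rewrite [RHS]linear0; apply: (expansive_fixed n0).
  by rewrite -[in RHS]fx -[RHS]/(to_phys S _) to_phys_exp.
have [N N0 [y Sy fy]] := fN _ (lattice_point_lattice lattice_b g).
exists N, y; split=> //.
suff : vsval (to_intl S y - N%:R *: w) = 0.
  move=> /(@val_inj _ _ _ _ 0) /subr0_eq ->.
  by rewrite scalerA mulVf ?scale1r// pnatr_eq0 -lt0n.
apply: f0; rewrite fE -restr_iter.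
have -> : iter n A (to_intl S y - N%:R *: w) = to_intl S y - N%:R *: w; last by rewrite subrr.
rewrite iter_homB iter_homZ wg -to_intl_exp.
have -> : lfun_exp M n y = y + N%:R *: lattice_point b g by rewrite -fy fE; zmod.
rewrite to_intlD scalerDr.
have -> : to_intl S (N%:R *: lattice_point b g) = N%:R *: q g by exact: linearZ.
by rewrite opprD [- (_ *: w) - _]addrC addrA addrK.
Qed.

End LatticeEndomorphism.

(** * The three equivalences, each reduced to pseudo self-affinity *)

Unset Implicit Arguments.
Set Strict Implicit.
Set Printing Implicit Defensive.

Theorem theorem3p15 (R : realType) (E : finNormedModType R) (S : cps E)
    (l : nat) (W : colored (subvs_of (intl S)) l)
    (W_polytopal : polytopal_window W)
    (W_vertex0 : Ver W 0)
    (M : 'End(E))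
    (M_auto : automorphism M)
    (M_lattice : M @` lattice S = lattice S)
    (M_phys : (M @: phys S)%VS = phys S)
    (M_intl : (M @: intl S)%VS = intl S)
    (L_expansive : expansive (phys_restr S M))
    (m : nat) (m_gt0 : (0 < m)%N)
    (Omega_sub : forall P, Omega W P -> is_sub (lfun_exp (phys_restr S M) m) P)
    (tau : colored (subvs_of (phys S)) l -> torus S)
    (tau_param : torus_parametrisation W tau)
    (P : colored (subvs_of (phys S)) l) (P_Omega : Omega W P) :
  let L := phys_restr S M in
  let rational := exists2 u : E,
    tau P = torus_class S u & rational_intl S (to_intl S u) in
  [/\ (exists2 p : nat, (0 < p)%N & LIDS (lfun_exp L p) P) <-> rational,
      (exists2 p : nat, (0 < p)%N & pseudo_self_affine (lfun_exp L p) P)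
        <-> rational
    & (exists2 p : nat, (0 < p)%N &
         exists2 sigma, substitution_map (Omega W) (lfun_exp L p) sigma
           & sigma P = P) <-> rational].
Proof.
have [b b_basis lattice_b] := lattice_full_rank S.
have W_window := W_polytopal.1.
have W_closed := window_closed W_window.
have W_regular i : W i `<=` closure (W i)° by rewrite {1}(W_window i).2.
have [B W_bounded] := window_bounded W_window.
have W_nonempty := Ver_interior_nonempty W_window W_vertex0.
have [Hs [W_boundary Hs_neq0]] := polytopal_hyperplanes W_polytopal.
have [i0 _ W_vertex] := W_vertex0.
have L_auto : automorphism (phys_restr S M) := restr_automorphism M_phys M_auto.
have A_auto := restr_automorphism M_intl M_auto.
have [K [rho [K0 rho0 rho1 L_contract]]] := expansive_contract L_auto L_expansive.
have [m' [_ p_m q_m m_surj]] := lattice_automorphism b_basis lattice_b M_lattice M_phys M_intl.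
have fin := lattice_phys_intl_finite S b_basis.
have p_inj := lattice_phys_inj b_basis lattice_b.
have dense_lattice := lattice_relatively_dense b_basis lattice_b.
have Omega_hull Q : Omega W Q <-> in_hull (lattice_phys S b) (lattice_intl S b) W Q.
  exact: OmegaE.
have approx_tau Q u : Omega W Q -> tau Q = torus_class S u ->
    approx (lattice_phys S b) (lattice_intl S b) W Q (to_phys S u) (to_intl S u).
  move=> /Omega_hull hQ.
  exact: (torus_approx b_basis lattice_b tau_param W_bounded W_nonempty).
have tau_class Q : exists u, tau Q = torus_class S u.
  by exists (repr (tau Q)); rewrite /torus_class reprK.
move=> L rational.
have hP : in_hull (lattice_phys S b) (lattice_intl S b) W P by exact/Omega_hull.
have self_affine_rat n : (0 < n)%N -> pseudo_self_affine (lfun_exp L n) P -> rational.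
  move=> n0 sa; have [u tu] := tau_class P; exists u => //.
  have [k k0 [g kg]] := self_affine_rational fin p_inj dense_lattice W_closed
    W_regular W_bounded W_nonempty L_auto A_auto p_m q_m K0 rho0 rho1
    L_contract W_boundary Hs_neq0 W_vertex hP (approx_tau _ _ P_Omega tu) n0 sa.
  exact: (periodic_rational b_basis lattice_b M_auto M_lattice M_phys M_intl
    K0 rho0 rho1 L_contract k0 kg).
have rat_self_affine : rational ->
    exists2 n, (0 < n)%N & pseudo_self_affine (lfun_exp L n) P.
  move=> [u tu ru]; have [P' [dP' lP' ld]] := Omega_sub _ P_Omega.
  have hP' := in_hull_LI hP lP'.
  have [u' tu'] := tau_class P'.
  apply: (rational_self_affine fin p_inj dense_lattice W_closed
    W_regular W_bounded W_nonempty L_auto A_auto p_m q_m m_surj K0 rho0 rho1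
    L_contract W_boundary Hs_neq0 W_vertex m_gt0 hP (approx_tau _ _ P_Omega tu)
    hP' (approx_tau _ _ _ tu') ld).
    exact/Omega_hull.
  by move=> k; exact: (rational_periodic b_basis lattice_b M_auto M_lattice M_phys M_intl ru).
split; split.
- by move=> [n n0 [_ sa]]; apply: self_affine_rat n0 sa.
- move=> /rat_self_affine[n n0 sa]; exists n => //; split=> //.
  have [u tu] := tau_class P.
  exact: (self_affine_LIDS fin p_inj dense_lattice W_closed
    W_regular W_bounded W_nonempty L_auto A_auto p_m q_m m_surj K0 rho0 rho1
    L_contract hP (approx_tau _ _ P_Omega tu) n0 sa).
- by move=> [n n0 sa]; apply: self_affine_rat n0 sa.
- exact: rat_self_affine.
(* The rule holds across the whole image of the hull; comparing two places in the one image of [P]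
   gives local derivability. *)
- move=> [n n0 [sigma [T [_ [c c0 hT]] sT] sP]]; apply: (self_affine_rat n n0).
  have TP : T (lin_image (lfun_exp L n) P) = P by rewrite -sT.
  exists c => // x y xy; rewrite -TP.
  by apply: hT xy; exists P.
- move=> /rat_self_affine[n n0 sa]; exists n => //.
  have [u tu] := tau_class P.
  have [sigma sub sP] := self_affine_substitution fin p_inj dense_lattice
    W_closed W_bounded L_auto hP sa.
  exists sigma => //.
  have -> : Omega W = in_hull (lattice_phys S b) (lattice_intl S b) W; last by [].
  by apply/seteqP; split=> Q; apply Omega_hull.
Qed.
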